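(* Let $v_1, v_2, v_3, v_4$ be positive integers with $\gcd(v_1,v_2,v_3,v_4) = 1$. (1) If there exist indices $i \neq j$ such that $v_i$ and $v_j$ have a common factor $g > 3$, then $\mathrm{ML}(v_1,v_2,v_3,v_4) \geq \frac14$. (2) If there exist indices $i \neq j$ such that $v_i$ and $v_j$ have the common factor $g = 3$, and $(v_1,v_2,v_3,v_4)$ is not, up to reordering, of the form $(1,2,3,12k)$ for a positive integer $k$, then $\mathrm{ML}(v_1,v_2,v_3,v_4) \geq \frac14$. (3) If $(v_1,v_2,v_3,v_4) = (1,2,3,12k)$ for a positive integer $k$, then $$\mathrm{ML}(v_1,v_2,v_3,v_4) = \frac{3k}{4(3k)+1}.$$
   Context: For real $x$, $\|x\|$ denotes the distance from $x$ to the nearest integer. For positive integers $v_1,\ldots,v_n$, the maximum loneliness is $\mathrm{ML}(v_1,\ldots,v_n) = \max_{t\in\mathbb{R}} \min_{1\le i\le n} \|t v_i\|$. *)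

(* Defs.v *)
From mathcomp Require Export all_boot all_order all_algebra.
From mathcomp Require Export all_classical all_reals all_analysis.
From mathcomp Require Import lra.
Export numFieldNormedType.Exports.

Set Implicit Arguments.
Unset Strict Implicit.
Unset Printing Implicit Defensive.

Import Order.TTheory GRing.Theory Num.Theory.

Local Open Scope classical_set_scope.
Local Open Scope ring_scope.

Definition dist_int (R : realType) (x : R) : R :=
  inf (range (fun m : int => `|x - m%:~R|)).

(* The default value of the iterated minimum is the term of index 0, so that
   it contributes nothing beyond the indexed terms. *)
Definition loneliness (R : realType) (n : nat) (v : n.+1.-tuple nat) (t : R)
    : R :=
  \big[Order.min/dist_int (t * (tnth v ord0)%:R)]_(i < n.+1)
     dist_int (t * (tnth v i)%:R).

(* This supremum is attained: see [ML_attained]. *)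
Definition ML (R : realType) (n : nat) (v : n.+1.-tuple nat) : R :=
  sup (range (fun t : R => loneliness v t)).

Section Attainment.
Variable R : realType.
Implicit Types (x y t : R) (m : int).

Lemma dist_int_le x m : dist_int x <= `|x - m%:~R|.
Proof.
apply: ge_inf; last by exists m.
by exists 0 => _ [k _ <-]; exact: normr_ge0.
Qed.

Lemma le_dist_int x y : (forall m, y <= `|x - m%:~R|) -> y <= dist_int x.
Proof.
move=> yx; apply: lb_le_inf; first by exists `|x - 0%:~R|; exists 0.
by move=> _ [m _ <-].
Qed.

Lemma dist_intD1 x m : dist_int (x + m%:~R) = dist_int x.
Proof.
apply/eqP; rewrite eq_le; apply/andP; split; apply: le_dist_int => k.
  by have := dist_int_le (x + m%:~R) (k + m);
    rewrite intrD opprD addrACA subrr addr0.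
have := dist_int_le x (k - m).
by rewrite intrB opprB addrA.
Qed.

Lemma dist_int_lip x y : `|dist_int x - dist_int y| <= `|x - y|.
Proof.
have H (a b : R) : dist_int a - dist_int b <= `|a - b|.
  rewrite lerBlDr -lerBlDl; apply: le_dist_int => m.
  rewrite lerBlDl; apply: (le_trans (dist_int_le a m)).
  exact: ler_distD.
by rewrite ler_norml H andbT lerNl opprB distrC H.
Qed.

Lemma dist_int_attained x : exists m, dist_int x = `|x - m%:~R|.
Proof.
set f := Num.floor x; have /andP[fx xf] := floor_itv x.
rewrite intrD in xf.
have near m : Num.min (x - f%:~R) (f%:~R + 1 - x) <= `|x - m%:~R|.
  rewrite ge_min; have [mf|fm] := leP m f; apply/orP; [left|right].
    have mfR : m%:~R <= f%:~R :> R by rewrite ler_int.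
    by apply: le_trans (ler_norm _); lra.
  have fmR : (f + 1)%:~R <= m%:~R :> R by rewrite ler_int lezD1.
  rewrite intrD in fmR; rewrite distrC.
  by apply: le_trans (ler_norm _); lra.
have [h|h] := leP (x - f%:~R) (f%:~R + 1 - x); [exists f|exists (f + 1)];
  apply/eqP; rewrite eq_le dist_int_le /=; apply: le_dist_int => m;
  apply: le_trans (near m).
  by rewrite min_l // ger0_norm ?subr_ge0.
rewrite min_r ?(ltW h) // distrC ger0_norm intrD //; lra.
Qed.

Lemma loneliness_continuous n (v : n.+1.-tuple nat) :
  continuous (fun t : R => loneliness v t).
Proof.
have dc : continuous (@dist_int R).
  move=> x; apply/cvgrPdist_le => e e0; near=> y.
  apply: (le_trans (dist_int_lip _ _)); near: y.
  exact: (@cvgr_dist_le _ _ _ _ _ id x).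
have tc (i : 'I_n.+1) :
    continuous (fun t : R => dist_int (t * (tnth v i)%:R)).
  move=> t; apply: (@continuous_comp _ _ _ (fun t => t * _) (@dist_int R)).
    exact: mulrr_continuous.
  exact: dc.
rewrite /loneliness => t.
elim: (index_enum _) => [|i s IH].
  under [X in continuous_at _ X]funext do rewrite big_nil.
  exact: tc.
under [X in continuous_at _ X]funext do rewrite big_cons.
exact: (@continuous_min _ _ _ _ _ (tc i t) IH).
Unshelve. all: by end_near.
Qed.

Lemma lonelinessD1 n (v : n.+1.-tuple nat) t m :
  loneliness v (t + m%:~R) = loneliness v t.
Proof.
have E k : dist_int ((t + m%:~R) * k%:R) = dist_int (t * k%:R).
  by rewrite mulrDl -[k%:R]/(k%:Z%:~R) -intrM dist_intD1.
by rewrite /loneliness E; apply: eq_bigr => i _; rewrite E.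
Qed.

Lemma ML_attained n (v : n.+1.-tuple nat) :
  (exists t, loneliness v t = ML R v) /\ (forall t, loneliness v t <= ML R v).
Proof.
have [c c01 cmax] : exists2 c, c \in `[0, 1]%R &
    forall t, t \in `[0, 1]%R -> loneliness v t <= loneliness v c.
  apply: (@EVT_max R (fun t => loneliness v t)) => //.
  exact: continuous_subspaceT (@loneliness_continuous n v).
have max t : loneliness v t <= loneliness v c.
  have /andP[fx xf] := floor_itv t; rewrite intrD in xf.
  rewrite -(lonelinessD1 v t (- Num.floor t)) mulrNz; apply: cmax.
  by rewrite in_itv /=; apply/andP; split; lra.
have ub : has_ubound (range (fun t : R => loneliness v t)).
  by exists (loneliness v c) => _ [t _ <-].
have le t : loneliness v t <= ML R v by apply: ub_le_sup => //; exists t.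
split=> //; exists c; apply/eqP; rewrite eq_le le /=.
apply: ge_sup; first by exists (loneliness v c), c.
by move=> _ [t _ <-].
Qed.

End Attainment.

(* Main.v *)
Require Import Defs.
From mathcomp Require Import zify ring lra.
Set Implicit Arguments.
Unset Strict Implicit.
Unset Printing Implicit Defensive.
Import Order.TTheory GRing.Theory Num.Theory.

Local Open Scope ring_scope.

(** Write ||x|| for [dist_int x].  Since ||-x|| = ||x||, speeds may be taken to
    be nonzero integers of either sign, and 1/4 <= ML means that at some time
    every runner is lonely: all four ||t v_i|| are at least 1/4.

    If h > 1 divides three of the speeds, it does not divide the fourth.  Take a
    time at which the three are lonely ([three_runners]); shifting it by
    multiples of 1/h does not move them, and it moves the fourth along a
    nonconstant progression on the circle, which cannot stay within 1/4 of the
    origin ([progression_lonely], [lonely4_common3]).  So put g = gcd(v1, v2),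
    v1 = g a, v2 = g b with a, b coprime, and suppose that v3 and v4 are prime
    to g ([pair_normal_form]).  At the times (s + k)/g, k an integer, the first
    two runners are at a s and b s, whatever k is, and the third one takes as
    positions all the points of a coset of (1/g)Z ([hit_interval]).

    Suppose g > 3.  If g > 5 and v4 is not +-v3 modulo g, then, while the third
    runner goes through consecutive lonely positions, the fourth one advances by
    steps of length at least 2/g; it covers half of the circle, and is lonely at
    some point ([walk_lonely], [lonely4_unrelated]).  For g = 4 the classes +-v3
    are the only ones prime to g, and g = 5 adds +-2 v3.  If v4 = +-2 v3 + 5 m
    and g = 5, a common lonely time s of three runners of speeds a, b, m will do
    ([lonely4_double_residue]).  Finally let v4 = v3 + g m, up to sign.  The
    fourth runner is then m s ahead of the third one, so the positions of the
    third one at which both are lonely form an arc of length 1/2 - ||m s||, and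
    it suffices that ||m s|| <= 1/2 - 1/g ([gap_lonely]).  Such an s, with a s
    and b s lonely, exists by an argument on parities ([quarter_or_tight]),
    unless the speeds are (4gk, g, v, v + g) up to sign and order.  For these
    an explicit time is found ([lonely4_tight_pair]).

    Suppose g = 3.  The same arc argument asks for ||m s|| <= 1/6, and yields a
    suitable s ([runners_sixth], [two_runners_third]) apart from the cases in
    which a suitable multiple of 1/12 is a lonely time ([lonely4_twelfths]) and
    the cases v4 - v3 = +-v1 and v4 - v3 = +-v2, again up to sign.  In these last
    cases, when parities do not settle the matter, one imposes v1 t = 1/4 or
    v2 t = 1/4 modulo 1, which leaves a quarter of the circle to the third
    runner, and walks along it ([lonely4_sum_even], [lonely4_sum_odd]).  This
    fails only for (12k, 3, v, v + 3), where a direct search for s succeeds for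
    all v but -1 and -2 ([lonely4_tight_pair3]); these two values give the
    speeds 1, 2, 3, 12k.

    For the latter put q = 3k/(12k + 1).  At t = q, the runners are at distance
    q or more.  Conversely, a t in (0, 1/2] that is at distance more than q for
    the speeds 1, 2, 3 lies in (q, (1 - q)/3), and then 12kt is within q of 3k
    ([ML_tight_family]). *)

(** * Distance to the nearest integer *)

Lemma dist_int_periodic (R : realType) (x y : R) (n : int) :
  x = y + n%:~R -> dist_int x = dist_int y.
Proof. by move->; exact: dist_intD1. Qed.

Lemma dist_intN (R : realType) (x : R) : dist_int (- x) = dist_int x.
Proof.
have le_opp (y : R) : dist_int (- y) <= dist_int y.
  apply: le_dist_int => m; apply: le_trans (dist_int_le _ (- m)) _.
  by rewrite intrN -opprD normrN.
apply/eqP; rewrite eq_le le_opp /=.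
by have := le_opp (- x); rewrite opprK.
Qed.

Lemma dist_int_ge (R : realType) (c x : R) (n : int) :
  n%:~R + c <= x -> x <= n%:~R + 1 - c -> c <= dist_int x.
Proof.
move=> nx xn; apply: le_dist_int => m.
have [mn|nm] := leP m n.
  have mnR : m%:~R <= n%:~R :> R by rewrite ler_int.
  by apply: le_trans (ler_norm _); lra.
have nmR : (n + 1)%:~R <= m%:~R :> R by rewrite ler_int lezD1.
rewrite distrC; apply: le_trans (ler_norm _); lra.
Qed.

Lemma quarter_window (R : realType) (x : R) (i : int) :
  1 / 4 <= x - i%:~R <= 3 / 4 -> 1 / 4 <= dist_int x.
Proof. by move=> /andP[? ?]; apply: (@dist_int_ge _ _ _ i); lra. Qed.

Lemma dist_int_gap (R : realType) (c x : R) :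
  c <= dist_int x -> exists n : int, n%:~R + c <= x <= n%:~R + 1 - c.
Proof.
move=> cx; exists (Num.floor x); have /andP[fx xf] := floor_itv x.
have cf := le_trans cx (dist_int_le x (Num.floor x)).
have cf1 := le_trans cx (dist_int_le x (Num.floor x + 1)).
rewrite ger0_norm in cf; last by lra.
rewrite ler0_norm in cf1; last by lra.
lra.
Qed.

Lemma dist_int_near (R : realType) (x : R) :
  exists n : int, n%:~R - dist_int x <= x <= n%:~R + dist_int x.
Proof.
have [n dn] := dist_int_attained x; exists n.
have := lexx `|x - n%:~R|; rewrite ler_norml -dn ; lra.
Qed.

Lemma dist_int_addhalf (R : realType) (x : R) :
  dist_int (x + 1 / 2) = 1 / 2 - dist_int x.
Proof.
have [n /andP[n_le le_n]] := dist_int_near x.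
have half : dist_int x <= 1 / 2.
  by have [m] := dist_int_gap (lexx (dist_int x)) => /=; lra.
apply/eqP; rewrite eq_le; apply/andP; split.
  have [|x_ge] := leP x n%:~R.
    have [m] := dist_int_gap (lexx (dist_int x)).
    move=> xm x_le.
    have : (n - 1)%:~R <= m%:~R :> R.
      rewrite ler_int; suff: (n < m + 2) by lia.
      by rewrite -(ltr_int R) intrD; lra.
    have : dist_int x = n%:~R - x.
      apply/eqP; rewrite eq_le; apply/andP; split; last by lra.
      have := dist_int_le x n; rewrite distrC ger0_norm; lra.
    move=> dxn _; have := dist_int_le (x + 1 / 2) n.
    by rewrite ger0_norm; lra.
  have dxn : dist_int x = x - n%:~R.
    apply/eqP; rewrite eq_le; apply/andP; split; last by lra.
    have := dist_int_le x n; rewrite ger0_norm; lra.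
  have := dist_int_le (x + 1 / 2) (n + 1).
  by rewrite intrD ler0_norm; lra.
by apply: (@dist_int_ge _ _ _ n); lra.
Qed.

Lemma dist_int_frac (R : realType) (p q : int) (q0 : 0 < q) : ~~ (q %| p)%Z ->
  1 / q%:~R <= dist_int (p%:~R / q%:~R : R).
Proof.
move=> qp; have qR : 0 < q%:~R :> R by rewrite ltr0z.
apply: (@dist_int_ge _ _ _ (p %/ q)%Z).
  rewrite ler_pdivlMr // mulrDl divfK ?gt_eqF // -intrM -[1]/(1%:~R) -intrD ler_int; lia.
rewrite ler_pdivrMr // mulrBl mulrDl divfK ?gt_eqF // mul1r.
by rewrite -[1]/(1%:~R) -intrM -intrD -intrB ler_int; lia.
Qed.

(** The fractions of denominator [q] closer to an integer than 2/q are those whose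
    numerator is 0 or +-1 modulo [q]. *)
Lemma dist_int_frac2 (R : realType) (p q : int) : 0 < q -> ~~ (q %| p)%Z ->
  ~~ (q %| p - 1)%Z -> ~~ (q %| p + 1)%Z -> 2 / q%:~R <= dist_int (p%:~R / q%:~R : R).
Proof.
move=> q0 qp qp1 qp1'; have qR : 0 < q%:~R :> R by rewrite ltr0z.
have pE := divz_eq p q; set n := (p %/ q)%Z in pE; set r := (p %% q)%Z in pE.
have r_ge0 : 0 <= r by rewrite modz_ge0 ?lt0r_neq0.
have r_lt : r < q by rewrite ltz_pmod.
have [r0 r1 r_1] : [/\ r != 0, r != 1 & r != q - 1].
  split; [apply: contraNneq qp|apply: contraNneq qp1|apply: contraNneq qp1'];
    move=> rE; rewrite pE rE ?addr0 ?addrK ?dvdz_mull ?dvdzz //.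
  by rewrite (_ : n * q + (q - 1) + 1 = (n + 1) * q) ?dvdz_mull //; ring.
have -> : p%:~R / q%:~R = n%:~R + r%:~R / q%:~R :> R.
  by rewrite {1}pE intrD intrM; field; exact: lt0r_neq0.
apply: (@dist_int_ge _ _ _ n); rewrite ?lerD2l -?addrA ?lerD2l.
  by rewrite ler_pM2r ?invr_gt0 // -[2]/(2%:~R) ler_int; clear -r_ge0 r0 r1; lia.
rewrite lerBrDr -mulrDl ler_pdivrMr // mul1r -[2]/(2%:~R) -intrD ler_int.
by clear -r_lt r_1; lia.
Qed.

Lemma dist_int_ratio (R : realType) (x q n : int) : 0 < q ->
  4 * q * n + q <= 4 * x -> 4 * x <= 4 * q * n + 3 * q ->
  1 / 4 <= dist_int (x%:~R / q%:~R : R).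
Proof.
move=> q0 nx xn; have qR : 0 < q%:~R :> R by rewrite ltr0z.
apply: (@dist_int_ge _ _ _ n).
  by rewrite ler_pdivlMr //; move: nx; rewrite -(ler_int R); clear; lra.
by rewrite ler_pdivrMr //; move: xn; rewrite -(ler_int R); clear; lra.
Qed.

Lemma dist_int_shift (R : realType) (s : R) (q a k : int) :
  q != 0 -> (q %| a)%Z -> dist_int ((s + k%:~R / q%:~R) * a%:~R) = dist_int (s * a%:~R).
Proof.
move=> q0 /dvdzP[c ->]; apply: (@dist_int_periodic _ _ _ (k * c)).
have qR : q%:~R != 0 :> R by rewrite intr_eq0.
rewrite !intrM; field; exact: qR.
Qed.

Lemma dist_int_halfshift_even (R : realType) (s : R) (a : int) :
  (2 %| a)%Z -> dist_int ((s + 1 / 2) * a%:~R) = dist_int (s * a%:~R).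
Proof. exact: (@dist_int_shift R s 2 a 1). Qed.

Lemma int_odd (b : int) : ~~ (2 %| b)%Z -> exists c, b = 2 * c + 1.
Proof. by move=> b_odd; exists (b %/ 2)%Z; lia. Qed.

Lemma dist_int_halfshift (R : realType) (s : R) (b : int) :
  ~~ (2 %| b)%Z -> dist_int ((s + 1 / 2) * b%:~R) = 1 / 2 - dist_int (s * b%:~R).
Proof.
move=> /int_odd[c ->]; rewrite -dist_int_addhalf.
apply: (@dist_int_periodic _ _ _ c); rewrite intrD intrM; lra.
Qed.

Lemma dist_int_quarter_odd (R : realType) (b : int) :
  ~~ (2 %| b)%Z -> dist_int (1 / 4 * b%:~R : R) = 1 / 4.
Proof.
move=> b_odd; have [c [->|->]] : exists c, b = 4 * c + 1 \/ b = 4 * c + 3.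
    by exists (b %/ 4)%Z; lia.
  have := dist_int_le (1 / 4 * (4 * c + 1)%:~R : R) c.
  rewrite intrD intrM ger0_norm => [le4|]; last lra.
  apply/eqP; rewrite eq_le; apply/andP; split; first lra.
  by apply: (@dist_int_ge _ _ _ c); lra.
have := dist_int_le (1 / 4 * (4 * c + 3)%:~R : R) (c + 1).
rewrite !intrD intrM ler0_norm => [le4|]; last lra.
apply/eqP; rewrite eq_le; apply/andP; split; first lra.
by apply: (@dist_int_ge _ _ _ c); lra.
Qed.

Lemma dist_int_half_odd (R : realType) (b : int) :
  ~~ (2 %| b)%Z -> 1 / 2 <= dist_int (1 / 2 * b%:~R : R).
Proof.
by move=> /int_odd[c ->]; apply: (@dist_int_ge _ _ _ c); rewrite intrD intrM; lra.
Qed.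

Lemma dist_int_half_even (R : realType) (b : int) :
  (2 %| b)%Z -> dist_int (1 / 2 * b%:~R : R) <= 0.
Proof.
move=> /dvdzP[c ->]; apply: le_trans (dist_int_le _ c) _.
by rewrite intrM [X in `|X|](_ : _ = 0) ?normr0 //; lra.
Qed.

Lemma dist_int_quarter_2mod4 (R : realType) (b : int) :
  (2 %| b)%Z -> ~~ (4 %| b)%Z -> 1 / 4 <= dist_int (1 / 4 * b%:~R : R).
Proof.
move=> b2 b4; have [c ->] : exists c, b = 4 * c + 2 by exists (b %/ 4)%Z; lia.
by apply: (@dist_int_ge _ _ _ c); rewrite intrD intrM; lra.
Qed.

Lemma dist_int_antipode (R : realType) (a : int) :
  a != 0 -> 1 / 2 <= dist_int (1 / (2 * a%:~R) * a%:~R : R).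
Proof.
move=> a0; have aR : a%:~R != 0 :> R by rewrite intr_eq0.
rewrite [X in dist_int X](_ : _ = 0%:~R + 1 / 2); last by rewrite add0r; field; exact: aR.
by apply: (@dist_int_ge _ _ _ 0); lra.
Qed.

Lemma dist_int_lift (R : realType) (s : R) (g a k : int) : 0 < g ->
  dist_int ((s + k%:~R) / g%:~R * (g * a)%:~R) = dist_int (s * a%:~R).
Proof.
move=> g0; have gR : g%:~R != 0 :> R by rewrite intr_eq0 lt0r_neq0.
apply: (@dist_int_periodic _ _ _ (k * a)).
by rewrite !intrM; field; exact: gR.
Qed.

Lemma dist_int_lift1 (R : realType) (s : R) (g k : int) : 0 < g ->
  dist_int ((s + k%:~R) / g%:~R * g%:~R) = dist_int s.
Proof. by move=> g0; rewrite divfK ?intr_eq0 ?lt0r_neq0 // dist_intD1. Qed.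

(** * Progressions on the circle *)

(** As long as the points stay within 1/4 of integers, the integer nearest to each
    one is obtained from the previous one by adding the integer nearest to [d]:
    two consecutive errors differ by less than 1/2 and ||d|| <= 1/2, so no other
    integer is possible.  The error thus drifts by ||d|| at each step, and after
    [K] steps it has moved by 1/2, which is too much. *)
Lemma progression_lonely (R : realType) (z d : R) (K : nat) :
  1 / 2 <= K%:R * dist_int d -> exists2 i : nat, (i <= K)%N & 1 / 4 <= dist_int (z + i%:R * d).
Proof.
move=> Kd; apply: contrapT => bad.
have bad_lt i : (i <= K)%N -> dist_int (z + i%:R * d) < 1 / 4.
  by move=> iK; rewrite ltNge; apply/negP => ge; apply: bad; exists i.
have [p dp] := dist_int_near d.
have d_half : dist_int d <= 1 / 2.
  by have [m] := dist_int_gap (lexx (dist_int d)); lra.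
have [n0 zn0] : exists n : int, n%:~R - 1 / 4 < z < n%:~R + 1 / 4.
  have := bad_lt 0%N isT; rewrite mul0r addr0.
  by have [n] := dist_int_near z; exists n; lra.
(* The position after i steps is within 1/4 of n0 + p i. *)
have walk i : (i <= K)%N ->
    (n0 + p * i%:Z)%:~R - 1 / 4 < z + i%:R * d < (n0 + p * i%:Z)%:~R + 1 / 4.
  elim: i => [|i IH] iK; first by rewrite mulr0 addr0 mul0r addr0.
  have {}IH := IH (ltnW iK); have := bad_lt _ iK.
  have [n zn] := dist_int_near (z + i.+1%:R * d) => small.
  have stepE : z + i.+1%:R * d = z + i%:R * d + d by rewrite -natr1; ring.
  have nE : (n0 + p * i.+1%:Z = n0 + p * i%:Z + p)%R by rewrite intS; ring.
  rewrite stepE in zn small *; set y := z + i%:R * d in IH zn small *.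
  suff -> : n0 + p * i.+1%:Z = n by move: zn small; set e := dist_int _; lra.
  rewrite nE; move: (n0 + p * i%:Z) IH => q IH.
  have : (q + p - 1 < n) && (n < q + p + 1).
    rewrite -!(ltr_int R) !intrD; move: zn small; set e := dist_int (y + d).
    lra.
  by clear; lia.
have := walk K (leqnn _).
have KE : (n0 + p * K%:Z)%:~R = n0%:~R + K%:R * p%:~R :> R.
  by rewrite intrD intrM -[K%:Z%:~R]/(K%:R); ring.
rewrite KE => wK.
have : K%:R * dist_int d <= `|K%:R * (d - p%:~R)|.
  by rewrite normrM ger0_norm //; apply: ler_wpM2l => //; exact: dist_int_le.
have : `|K%:R * (d - p%:~R)| < 1 / 2.
  by rewrite ltr_norml; lra.
lra.
Qed.

(** The times t + i/q do not move a runner whose speed is divisible by [q]; this is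
    how another runner is made lonely meanwhile. *)
Lemma shift_lonely (R : realType) (z : R) (p q : int) : 0 < q -> ~~ (q %| p)%Z ->
  exists i : int, 1 / 4 <= dist_int (z + i%:~R * (p%:~R / q%:~R)).
Proof.
move=> q0 qp; have qR : 0 < q%:~R :> R by rewrite ltr0z.
have reach : 1 / 2 <= `|q|%N%:R * dist_int (p%:~R / q%:~R : R).
  apply: (@le_trans _ _ (`|q|%N%:R * (1 / q%:~R))).
    rewrite -[`|q|%N%:R]/(`|q|%N%:Z%:~R) gtz0_abs // mulrA mulr1 mulfV ?gt_eqF //.
    lra.
  by rewrite ler_wpM2l // dist_int_frac.
by have [i _ i_far] := progression_lonely z reach; exists i%:Z.
Qed.

Lemma coprimez_prime (b p : int) : 0 < p -> prime `|p| -> ~~ (p %| b)%Z -> coprimez b p.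
Proof.
move=> p0 p_pr pb; rewrite coprimezE coprime_sym prime_coprime //.
Qed.

Lemma coprimez4 (b : int) : ~~ (2 %| b)%Z -> coprimez b 4.
Proof.
move=> b2; have b2' : coprimez b 2 by exact: coprimez_prime.
by rewrite (_ : 4 = 2 * 2) // coprimezMr b2'.
Qed.

Lemma dvdz_opp (d m : int) : (d %| - m)%Z = (d %| m)%Z.
Proof. by rewrite !dvdzE abszN. Qed.

(** Bezout: among the times (s + k)/g, one brings the runner of speed [v] to any
    prescribed point above its position at time s. *)
Lemma lift_residue (R : realType) (g v N : int) : 0 < g -> coprimez v g ->
  exists k l : int, forall s : R,
    (s + k%:~R) / g%:~R * v%:~R + l%:~R = (s * v%:~R + N%:~R) / g%:~R.
Proof.
move=> g0 /coprimezP[[u w] /= uw].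
have gR : g%:~R != 0 :> R by rewrite intr_eq0 lt0r_neq0.
exists (u * N), (w * N) => s.
have uwR : u%:~R * v%:~R + w%:~R * g%:~R = 1 :> R by rewrite -!intrM -intrD uw.
have NE : N%:~R = (u%:~R * v%:~R + w%:~R * g%:~R) * N%:~R :> R by rewrite uwR mul1r.
by rewrite !intrM [in RHS]NE; field; exact: gR.
Qed.

Lemma hit_interval (R : realType) (g v : int) (s lo : R) : 0 < g -> coprimez v g ->
  exists k l : int, lo <= (s + k%:~R) / g%:~R * v%:~R + l%:~R < lo + 1 / g%:~R.
Proof.
move=> g0 vg; have gR : 0 < g%:~R :> R by rewrite ltr0z.
have /andP[] := ceil_itv (g%:~R * lo - s * v%:~R).
set j := Num.ceil _ => j_gt j_ge; rewrite intrB in j_gt.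
have [k [l kl]] := lift_residue R j g0 vg; exists k, l; rewrite kl.
rewrite ler_pdivlMr // ltr_pdivrMr // mulrDl divfK ?lt0r_neq0 //; lra.
Qed.

(** Let the runner of speed [v] occupy consecutive points of its coset of (1/g)Z,
    starting at the first one after [lo].  The runner of speed [w] then moves in
    constant steps of u w/g, where [u] is inverse to [v] modulo [g], and the
    hypothesis says that [K] such steps cover half of the circle. *)
Lemma walk_lonely (R : realType) (g v w : int) (K : nat) (s lo : R) : 0 < g ->
  coprimez v g ->
  (forall u q, u * v + q * g = 1 -> 1 / 2 <= K%:R * dist_int ((u * w)%:~R / g%:~R : R)) ->
  exists k l : int,
    lo <= (s + k%:~R) / g%:~R * v%:~R + l%:~R < lo + (K%:R + 1) / g%:~R /\
    1 / 4 <= dist_int ((s + k%:~R) / g%:~R * w%:~R).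
Proof.
move=> g0 vg reach; have gR : 0 < g%:~R :> R by rewrite ltr0z.
have gN0 : g%:~R != 0 :> R by rewrite gt_eqF.
have [k [l /andP[kl_ge kl_lt]]] := hit_interval s lo g0 vg.
have [[u q] /= uq] := coprimezP _ _ vg.
have uqR : u%:~R * v%:~R + q%:~R * g%:~R = 1 :> R by rewrite -!intrM -intrD uq.
have [i iK far] := progression_lonely ((s + k%:~R) / g%:~R * w%:~R) (reach u q uq).
exists (k + u * i%:Z), (l + i%:Z * q); split; last first.
  have -> // : (s + (k + u * i%:Z)%:~R) / g%:~R * w%:~R
      = (s + k%:~R) / g%:~R * w%:~R + i%:R * ((u * w)%:~R / g%:~R).
  by rewrite intrD !intrM -[i%:Z%:~R]/(i%:R); field.
have -> : (s + (k + u * i%:Z)%:~R) / g%:~R * v%:~R + (l + i%:Z * q)%:~R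
    = (s + k%:~R) / g%:~R * v%:~R + l%:~R + i%:R / g%:~R.
  have -> : i%:R / g%:~R = i%:R * (u%:~R * v%:~R + q%:~R * g%:~R) / g%:~R :> R.
    by rewrite uqR mulr1.
  by rewrite !intrD !intrM -[i%:Z%:~R]/(i%:R); field.
have i_ge0 : 0 <= i%:R / g%:~R :> R by rewrite divr_ge0 ?ler0n ?(ltW gR).
have i_le : i%:R / g%:~R <= K%:R / g%:~R :> R by rewrite ler_pM2r ?invr_gt0 // ler_nat.
by rewrite mulrDl; apply/andP; split; lra.
Qed.

(** At time (s + k)/g the second runner is s m ahead of the first modulo 1.  With
    e = ||s m||, both are lonely while the first one is on an arc of length
    1/2 - e, which is at least the spacing 1/g of its possible positions. *)
Lemma gap_lonely (R : realType) (g v m : int) (s : R) : 0 < g -> coprimez v g ->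
  dist_int (s * m%:~R) <= 1 / 2 - 1 / g%:~R ->
  exists k : int, 1 / 4 <= dist_int ((s + k%:~R) / g%:~R * v%:~R) /\
    1 / 4 <= dist_int ((s + k%:~R) / g%:~R * (v + g * m)%:~R).
Proof.
move=> g0 vg; have gR : g%:~R != 0 :> R by rewrite intr_eq0 gt_eqF.
have [n] := dist_int_near (s * m%:~R); set e := dist_int _ => sm e_small.
(* The arc starts at 1/4, or later if the second runner is behind the first. *)
have [k [l kl]] := hit_interval s (1 / 4 + Num.max 0 (n%:~R - s * m%:~R)) g0 vg.
exists k.
have -> : (s + k%:~R) / g%:~R * (v + g * m)%:~R =
    (s + k%:~R) / g%:~R * v%:~R + s * m%:~R + (k * m)%:~R.
  by rewrite intrD !intrM; field; exact: gR.
set x := _ * v%:~R in kl *; set y := 1 / g%:~R in kl e_small.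
rewrite dist_intD1.
have : 0 < y by rewrite divr_gt0 // ltr0z.
move=> y0; split.
  apply: (@dist_int_ge _ _ _ (- l)); rewrite intrN;
    by move: kl; rewrite maxEle; case: ifP; lra.
apply: (@dist_int_ge _ _ _ (n - l)); rewrite intrB;
  by move: kl; rewrite maxEle; case: ifP; lra.
Qed.

(** The shifts by k/4 preserve the difference of the two positions, as 4 divides
    [b - m]; when this difference is at least [c] in distance, the positions of
    the first runner for which both conclusions hold form an arc of length at
    least 1/4, which contains one of its four possible positions. *)
Lemma quarter_shift (R : realType) (b m : int) (s c : R) : ~~ (2 %| b)%Z ->
  (4 %| b - m)%Z -> 1 / 4 <= c -> c <= 1 / 3 -> c <= dist_int (s * (b - m)%:~R) ->
  exists k : int, 1 / 4 <= dist_int ((s + k%:~R / 4%:~R) * b%:~R) /\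
    dist_int ((s + k%:~R / 4%:~R) * m%:~R) <= 1 / 2 - c.
Proof.
move=> b2 /dvdzP[q bm] c4 c3 /dist_int_gap[n].
set th := s * _ => th_gap.
have cop : coprimez b 4 by exact: coprimez4.
(* The first position has to be both in [1/4, 3/4] and within 1/2 - c of th - n. *)
have [k [l kl]] :=
  hit_interval (4 * s) (Num.max (1 / 4) (th - n%:~R - 1 / 2 + c)) (isT : 0 < 4 :> int) cop.
exists k.
have sE : s + k%:~R / 4%:~R = (4 * s + k%:~R) / 4%:~R by lra.
rewrite sE; set x := _ * b%:~R in kl *.
have -> : (4 * s + k%:~R) / 4%:~R * m%:~R = x - th - (k * q)%:~R.
  have mE : m = b - q * 4 by lia.
  by rewrite /x /th bm mE !intrB !intrM; field.
split.
  apply: (@dist_int_ge _ _ _ (- l)); rewrite intrN;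
    by move: kl; rewrite maxEle; case: ifP; lra.
apply: le_trans (dist_int_le _ (- l - n - k * q)) _.
rewrite !intrB intrN ler_norml.
by move: kl; rewrite maxEle; case: ifP; lra.
Qed.

(** * Two and three runners *)

(** Lonely times rescale ([scale_time]), so that in looking for them one may divide
    the speeds by their gcd; all that is used afterwards is that no integer
    divides all of the quotients. *)
Lemma gcd_split3 (a b c : int) : a != 0 ->
  exists g a' b' c' : int, [/\ 0 < g, a = g * a', b = g * b', c = g * c' &
    forall q, 1 < q -> ~~ [&& (q %| a')%Z, (q %| b')%Z & (q %| c')%Z]].
Proof.
move=> a0; set g := gcdz (gcdz a b) c.
have g_gt0 : 0 < g.
  by rewrite lt_neqAle eq_sym !gcdz_eq0 (negPf a0).
have ga : (g %| a)%Z by rewrite (dvdz_trans (dvdz_gcdl _ _)) // dvdz_gcdl.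
have gb : (g %| b)%Z by rewrite (dvdz_trans (dvdz_gcdl _ _)) // dvdz_gcdr.
have gc : (g %| c)%Z by rewrite dvdz_gcdr.
have [a' aE] := dvdzP ga; have [b' bE] := dvdzP gb; have [c' cE] := dvdzP gc.
exists g, a', b', c'; split; rewrite // 1?mulrC // => q q1.
apply/negP=> /and3P[qa qb qc].
have : (q * g %| gcdz (gcdz a b) c)%Z.
  by rewrite !dvdz_gcd aE bE cE !dvdz_mul.
rewrite -/g -{1}[g]mul1r dvdz_mul2r ?gt_eqF // dvdz1 => /eqP; clear -q1; lia.
Qed.

Lemma gcd_split2 (a b : int) : a != 0 ->
  exists g a' b' : int, [/\ 0 < g, a = g * a', b = g * b' &
    forall q, 1 < q -> ~~ ((q %| a')%Z && (q %| b')%Z)].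
Proof.
move=> a0; have [g [a' [b' [c' [g0 aE bE cE no_dvd]]]]] := gcd_split3 b b a0.
have cb : c' = b' by apply: (mulfI (lt0r_neq0 g0)); rewrite -cE -bE.
exists g, a', b'; split=> // q q1.
by have := no_dvd q q1; rewrite cb andbb.
Qed.

Lemma scale_time (R : realType) (s : R) (g a : int) : 0 < g ->
  s / g%:~R * (g * a)%:~R = s * a%:~R.
Proof.
move=> g0; have gR : g%:~R != 0 :> R by rewrite intr_eq0 gt_eqF.
by rewrite intrM mulrA divfK.
Qed.

(** Adding 1/2 to the time only moves the second runner, and to the opposite point. *)
Lemma even_odd_lonely (R : realType) (a b : int) (c s : R) :
  (2 %| a)%Z -> ~~ (2 %| b)%Z -> c <= dist_int (s * a%:~R) ->
  exists s' : R, c <= dist_int (s' * a%:~R) /\ 1 / 4 <= dist_int (s' * b%:~R).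
Proof.
move=> a2 b2 sa; have [sb|sb] := leP (1 / 4) (dist_int (s * b%:~R)).
  by exists s.
exists (s + 1 / 2); split; first by rewrite dist_int_halfshift_even.
by rewrite dist_int_halfshift //; lra.
Qed.

(** After division by the gcd, either both speeds are odd and 1/2 is a lonely time,
    or one is even and [even_odd_lonely] applies. *)
Lemma two_runners (R : realType) (a b : int) : a != 0 -> b != 0 ->
  exists s : R, 1 / 4 <= dist_int (s * a%:~R) /\ 1 / 4 <= dist_int (s * b%:~R).
Proof.
move=> a0 b0; have [g [a' [b' [g0 aE bE /(_ 2 isT) not_both]]]] := gcd_split2 b a0.
have a'0 : a' != 0 by move: a0; rewrite aE mulf_eq0 negb_or => /andP[].
have b'0 : b' != 0 by move: b0; rewrite bE mulf_eq0 negb_or => /andP[].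
suff [s [sa sb]] : exists s : R,
    1 / 4 <= dist_int (s * a'%:~R) /\ 1 / 4 <= dist_int (s * b'%:~R).
  by exists (s / g%:~R); rewrite aE bE !scale_time.
have antipode (n : int) : n != 0 -> 1 / 4 <= dist_int (1 / (2 * n%:~R) * n%:~R : R).
  by move=> /(dist_int_antipode R); lra.
have [a2|a2] := boolP (2 %| a')%Z; have [b2|b2] := boolP (2 %| b')%Z.
- by exfalso; move: not_both; rewrite a2 b2; lia.
- exact: even_odd_lonely a2 b2 (antipode _ a'0).
- by have [s [sb sa]] := even_odd_lonely b2 a2 (antipode _ b'0); exists s.
exists (1 / 2); have := dist_int_half_odd R a2; have := dist_int_half_odd R b2.
by split; lra.
Qed.

(** After division by the gcd, [a] or [m] is odd.  If [a] is odd, take s = 1/2 when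
    [m] is even and s = 1/4, which puts both distances at 1/4, when [m] is odd.
    If [a] is even, put a s at 1/2; a shift by 1/2 then corrects m s if needed. *)
Lemma mixed_runners (R : realType) (a m : int) : a != 0 ->
  exists s : R, 1 / 4 <= dist_int (s * a%:~R) /\ dist_int (s * m%:~R) <= 1 / 4.
Proof.
move=> a0; have [g [a' [m' [g0 aE mE /(_ 2 isT) not_both]]]] := gcd_split2 m a0.
have a'0 : a' != 0 by move: a0; rewrite aE mulf_eq0 negb_or => /andP[].
suff [s [sa sm]] : exists s : R,
    1 / 4 <= dist_int (s * a'%:~R) /\ dist_int (s * m'%:~R) <= 1 / 4.
  by exists (s / g%:~R); rewrite aE mE !scale_time.
have [a2|a2] := boolP (2 %| a')%Z; have [m2|m2] := boolP (2 %| m')%Z.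
- by exfalso; move: not_both; rewrite a2 m2; lia.
- have half := dist_int_antipode R a'0.
  set s := 1 / (2 * a'%:~R) in half.
  have [sm|sm] := leP (dist_int (s * m'%:~R)) (1 / 4); first by exists s; split; lra.
  exists (s + 1 / 2); rewrite dist_int_halfshift_even // dist_int_halfshift //.
  by split; lra.
- exists (1 / 2); have := dist_int_half_odd R a2; have := dist_int_half_even R m2.
  by split; lra.
by exists (1 / 4); rewrite !dist_int_quarter_odd.
Qed.

(** When 4 divides [a], the times s + k/4 do not move the first runner.  Changing
    the sign of [c] if necessary, 4 divides [c - b], and [gap_lonely] for g = 4
    reduces the question to ||s (c - b)|| <= 1/4, that is, to [mixed_runners]. *)
Lemma three_runners_even1 (R : realType) (a b c : int) : a != 0 ->
  (2 %| a)%Z -> ~~ (2 %| b)%Z -> ~~ (2 %| c)%Z ->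
  exists s : R, [/\ 1 / 4 <= dist_int (s * a%:~R), 1 / 4 <= dist_int (s * b%:~R)
    & 1 / 4 <= dist_int (s * c%:~R)].
Proof.
move=> a0 a2 b2; wlog : c / (4 %| c - b)%Z.
  move=> wlg c2; have [cb|cb] := boolP (4 %| c - b)%Z; first exact: wlg.
  have cb' : (4 %| - c - b)%Z by lia.
  have c2' : ~~ (2 %| - c)%Z by lia.
  have [s [sa sb]] := wlg _ cb' c2'.
  by rewrite intrN mulrN dist_intN => sc; exists s.
move=> cb c2.
have [a4|a4] := boolP (4 %| a)%Z; last first.
  by exists (1 / 4); split; [exact: dist_int_quarter_2mod4|rewrite dist_int_quarter_odd..].
have [m cbE] := dvdzP cb.
have [s [sa sm]] := @mixed_runners R a (4 * m) a0.
have b4 : coprimez b 4 by exact: coprimez4.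
have sm' : dist_int ((4 * s) * m%:~R) <= 1 / 2 - 1 / 4%:~R.
  by have -> : 4 * s * m%:~R = s * (4 * m)%:~R; [rewrite intrM; lra|lra].
have [k [sb sc]] := gap_lonely (isT : 0 < 4 :> int) b4 sm'.
have sE : (4 * s + k%:~R) / 4%:~R = s + k%:~R / 4%:~R by lra.
rewrite sE in sb sc; exists (s + k%:~R / 4%:~R); split=> //.
  by rewrite dist_int_shift.
by have <- : b + 4 * m = c by lia.
Qed.

Lemma three_runners (R : realType) (a b c : int) : a != 0 -> b != 0 -> c != 0 ->
  exists s : R, [/\ 1 / 4 <= dist_int (s * a%:~R), 1 / 4 <= dist_int (s * b%:~R)
    & 1 / 4 <= dist_int (s * c%:~R)].
Proof.
move=> a0 b0 c0.
have [g [a' [b' [c' [g0 aE bE cE /(_ 2 isT) not_all]]]]] := gcd_split3 b c a0.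
have a'0 : a' != 0 by move: a0; rewrite aE mulf_eq0 negb_or => /andP[].
have b'0 : b' != 0 by move: b0; rewrite bE mulf_eq0 negb_or => /andP[].
have c'0 : c' != 0 by move: c0; rewrite cE mulf_eq0 negb_or => /andP[].
suff [s [sa sb sc]] : exists s : R, [/\ 1 / 4 <= dist_int (s * a'%:~R),
    1 / 4 <= dist_int (s * b'%:~R) & 1 / 4 <= dist_int (s * c'%:~R)].
  by exists (s / g%:~R); rewrite aE bE cE !scale_time.
have even2 (x y z : int) : x != 0 -> y != 0 -> (2 %| x)%Z -> (2 %| y)%Z -> ~~ (2 %| z)%Z ->
    exists s : R, [/\ 1 / 4 <= dist_int (s * x%:~R),
    1 / 4 <= dist_int (s * y%:~R) & 1 / 4 <= dist_int (s * z%:~R)].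
  move=> x0 y0 x2 y2 z2; have [s [sx sy]] := two_runners R x0 y0.
  have [sz|sz] := leP (1 / 4) (dist_int (s * z%:~R)); first by exists s.
  exists (s + 1 / 2).
  rewrite (dist_int_halfshift_even _ x2) (dist_int_halfshift_even _ y2).
  by rewrite dist_int_halfshift //; split=> //; lra.
have [a2|a2] := boolP (2 %| a')%Z; have [b2|b2] := boolP (2 %| b')%Z;
  have [c2|c2] := boolP (2 %| c')%Z.
- by exfalso; move: not_all; rewrite a2 b2 c2.
- exact: even2.
- by have [s [? ? ?]] := even2 _ _ _ a'0 c'0 a2 c2 b2; exists s.
- exact: three_runners_even1.
- by have [s [? ? ?]] := even2 _ _ _ b'0 c'0 b2 c2 a2; exists s.
- by have [s [? ? ?]] := three_runners_even1 R b'0 b2 a2 c2; exists s.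
- by have [s [? ? ?]] := three_runners_even1 R c'0 c2 a2 b2; exists s.
exists (1 / 2); have := dist_int_half_odd R a2; have := dist_int_half_odd R b2.
by have := dist_int_half_odd R c2; split; lra.
Qed.

(** Shifts by k/3 only move the runner of speed [b], whose three positions are
    spaced by 1/3. *)
Lemma two_runners_third_shift (R : realType) (a b : int) : a != 0 -> (3 %| a)%Z -> ~~ (3 %| b)%Z ->
  exists s : R, 1 / 3 <= dist_int (s * a%:~R) /\ 1 / 3 <= dist_int (s * b%:~R).
Proof.
move=> a0 a3 b3; set s0 : R := 1 / (2 * a%:~R).
have b3' : coprimez b 3 by exact: coprimez_prime.
have [k [l kl]] := hit_interval (3 * s0) (1 / 3) (isT : 0 < 3 :> int) b3'.
have sE : (3 * s0 + k%:~R) / 3%:~R = s0 + k%:~R / 3%:~R by lra.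
rewrite sE in kl; exists (s0 + k%:~R / 3%:~R); split.
  by rewrite dist_int_shift //; have := dist_int_antipode R a0; rewrite -/s0; lra.
by apply: (@dist_int_ge _ _ _ (- l)); rewrite intrN; lra.
Qed.

Lemma two_runners_third (R : realType) (a b : int) : a != 0 -> b != 0 ->
  exists s : R, 1 / 3 <= dist_int (s * a%:~R) /\ 1 / 3 <= dist_int (s * b%:~R).
Proof.
move=> a0 b0; have [g [a' [b' [g0 aE bE /(_ 3 isT) not_both]]]] := gcd_split2 b a0.
have a'0 : a' != 0 by move: a0; rewrite aE mulf_eq0 negb_or => /andP[].
have b'0 : b' != 0 by move: b0; rewrite bE mulf_eq0 negb_or => /andP[].
suff [s [sa sb]] : exists s : R,
    1 / 3 <= dist_int (s * a'%:~R) /\ 1 / 3 <= dist_int (s * b'%:~R).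
  by exists (s / g%:~R); rewrite aE bE !scale_time.
have third (n : int) : ~~ (3 %| n)%Z -> 1 / 3 <= dist_int (1 / 3%:~R * n%:~R : R).
  move=> n3; have -> : 1 / 3%:~R * n%:~R = n%:~R / 3%:~R :> R by rewrite mulrAC mul1r.
  have := dist_int_frac R (isT : 0 < 3 :> int) n3; lra.
have [a3|a3] := boolP (3 %| a')%Z; have [b3|b3] := boolP (3 %| b')%Z.
- by exfalso; move: not_both; rewrite a3 b3.
- exact: two_runners_third_shift.
- by have [s [? ?]] := two_runners_third_shift R b'0 b3 a3; exists s.
by exists (1 / 3%:~R); split; exact: third.
Qed.

(** If [m] does not divide [a], take s = i/m, so that the second distance is 0.  If
    a = c m with |c| >= 3, then s = 1/(2a) gives the distances 1/2 and
    1/(2|c|); if |c| = 2, s = 1/(8m) does.  For |c| = 1 the two conclusions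
    contradict each other. *)
Lemma runners_sixth (R : realType) (a m : int) : a != 0 -> m != a -> m != - a ->
  exists s : R, 1 / 4 <= dist_int (s * a%:~R) /\ dist_int (s * m%:~R) <= 1 / 6.
Proof.
move=> a0; wlog m_ge0 : m / 0 <= m.
  move=> wlg ma mNa; have [m0|m0] := leP 0 m; first exact: wlg.
  have [||//|s [sa]] := wlg (- m); [by lia| |by rewrite eqr_opp|].
    by rewrite eqr_oppLR.
  by rewrite intrN mulrN dist_intN => sm; exists s.
move=> ma mNa; have aR : a%:~R != 0 :> R by rewrite intr_eq0.
have antipode := dist_int_antipode R a0.
have [m0|m0] := eqVneq m 0.
  exists (1 / (2 * a%:~R)); split; first lra.
  by rewrite m0 mulr0; have := dist_int_le (0 : R) 0; rewrite subr0 normr0; lra.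
have {m_ge0 m0} m0 : 0 < m by lia.
have mR : m%:~R != 0 :> R by rewrite intr_eq0 lt0r_neq0.
have [/dvdzP[c aE]|m_a] := boolP (m %| a)%Z; last first.
  have [i] := shift_lonely (0 : R) m0 m_a; rewrite add0r => far.
  exists (i%:~R / m%:~R); split; first by rewrite mulrAC -mulrA.
  rewrite divfK //; have := dist_int_le (i%:~R : R) i; rewrite subrr normr0; lra.
have c0 : c != 0 by apply: contraNneq a0 => c0; rewrite aE c0 mul0r.
have cR : c%:~R != 0 :> R by rewrite intr_eq0.
have c_big : `|c| != 1 by apply/negP; rewrite aE in ma mNa; lia.
have [c2|c3] := eqVneq `|c| 2.
  exists (1 / (8 * m%:~R)).
  have -> : 1 / (8 * m%:~R) * a%:~R = c%:~R / 8 :> R.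
    by rewrite aE intrM; field; exact: mR.
  have -> : 1 / (8 * m%:~R) * m%:~R = 1 / 8 :> R by field; exact: mR.
  split; last by have := dist_int_le (1 / 8 : R) 0; rewrite subr0 ger0_norm; lra.
  have [->|->] : c = 2 \/ c = - 2 by lia.
    by apply: (@dist_int_ge _ _ _ 0); lra.
  by rewrite intrN mulNr dist_intN; apply: (@dist_int_ge _ _ _ 0); lra.
exists (1 / (2 * a%:~R)); split; first lra.
have -> : 1 / (2 * a%:~R) * m%:~R = (2 * c%:~R)^-1 :> R.
  by rewrite aE intrM; field; rewrite mR cR.
apply: le_trans (dist_int_le _ 0) _; rewrite subr0 normfV normrM [`|2|]ger0_norm //.
rewrite mul1r lef_pV2 ?posrE ?mulr_gt0 ?normr_gt0 //.
have : (3%:~R : R) <= `|c|%:~R by rewrite ler_int; lia.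
by rewrite intr_norm; lra.
Qed.

(** * Four runners *)

Definition lonely4 (R : realType) (a b c d : int) : Prop :=
  exists t : R, [/\ 1 / 4 <= dist_int (t * a%:~R), 1 / 4 <= dist_int (t * b%:~R),
    1 / 4 <= dist_int (t * c%:~R) & 1 / 4 <= dist_int (t * d%:~R)].

Lemma lonely4C12 (R : realType) (a b c d : int) :
  lonely4 R b a c d -> lonely4 R a b c d.
Proof. by case=> t [? ? ? ?]; exists t. Qed.

Lemma lonely4C34 (R : realType) (a b c d : int) :
  lonely4 R a b d c -> lonely4 R a b c d.
Proof. by case=> t [? ? ? ?]; exists t. Qed.

Lemma lonely4_swap (R : realType) (a b c d : int) :
  lonely4 R c d a b -> lonely4 R a b c d.
Proof. by case=> t [? ? ? ?]; exists t. Qed.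

Lemma lonely4N (R : realType) (a b c d : int) :
  lonely4 R a b c (- d) -> lonely4 R a b c d.
Proof. by case=> t [? ? ?]; rewrite intrN mulrN dist_intN => ?; exists t. Qed.

Lemma lonely4N1 (R : realType) (a b c d : int) :
  lonely4 R (- a) b c d -> lonely4 R a b c d.
Proof. by case=> t []; rewrite intrN mulrN dist_intN => ? ? ? ?; exists t. Qed.

Lemma lonely4N2 (R : realType) (a b c d : int) :
  lonely4 R a (- b) c d -> lonely4 R a b c d.
Proof. by move=> h; apply: lonely4C12; apply: lonely4N1; apply: lonely4C12. Qed.

(** The three runners are made lonely first, then the fourth one by shifts of 1/h. *)
Lemma lonely4_common3 (R : realType) (h a b c d : int) : 1 < h ->
  (h %| a)%Z -> (h %| b)%Z -> (h %| c)%Z -> ~~ (h %| d)%Z ->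
  a != 0 -> b != 0 -> c != 0 -> lonely4 R a b c d.
Proof.
move=> h1 ha hb hc hd a0 b0 c0; have h0 : 0 < h by lia.
have [s [sa sb sc]] := three_runners R a0 b0 c0.
have [i far] := shift_lonely (s * d%:~R) h0 hd.
have h_neq0 : h != 0 by rewrite lt0r_neq0.
exists (s + i%:~R / h%:~R).
rewrite (dist_int_shift _ _ h_neq0 ha) (dist_int_shift _ _ h_neq0 hb).
rewrite (dist_int_shift _ _ h_neq0 hc); split=> //.
by rewrite mulrDl mulrAC -mulrA.
Qed.

(** If v3 or v4 has a factor in common with gcd(v1, v2), this factor is common to
    three of the speeds, and [lonely4_common3] applies. *)
Lemma pair_normal_form (R : realType) (v1 v2 v3 v4 : int) :
  v1 != 0 -> v2 != 0 -> v3 != 0 -> v4 != 0 ->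
  (forall q, 1 < q -> ~~ [&& (q %| v1)%Z, (q %| v2)%Z, (q %| v3)%Z & (q %| v4)%Z]) ->
  lonely4 R v1 v2 v3 v4 \/ exists a b, [/\ v1 = gcdz v1 v2 * a, v2 = gcdz v1 v2 * b,
    coprimez a b, coprimez v3 (gcdz v1 v2) & coprimez v4 (gcdz v1 v2)].
Proof.
move=> v1_0 v2_0 v3_0 v4_0 nodiv; set g := gcdz v1 v2.
have g_gt0 : 0 < g by rewrite lt_neqAle eq_sym gcdz_eq0 (negPf v1_0).
have g1 : (g %| v1)%Z by exact: dvdz_gcdl.
have g2 : (g %| v2)%Z by exact: dvdz_gcdr.
have gcd_gt1 (x : int) : ~~ coprimez x g -> 1 < gcdz x g.
  move=> xg; rewrite lt_neqAle eq_sym -/(coprimez _ _) xg /=.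
  have : 0 < gcdz x g by rewrite lt_neqAle eq_sym gcdz_eq0 (gt_eqF g_gt0) andbF.
  by clear; lia.
have [v3g|/gcd_gt1 h3] := boolP (coprimez v3 g); last first.
  have hg : (gcdz v3 g %| g)%Z by exact: dvdz_gcdr.
  have hv1 := dvdz_trans hg g1; have hv2 := dvdz_trans hg g2.
  have hv3 : (gcdz v3 g %| v3)%Z by exact: dvdz_gcdl.
  left; apply: (lonely4_common3 R h3) => //.
  by have := nodiv _ h3; rewrite hv1 hv2 hv3.
have [v4g|/gcd_gt1 h4] := boolP (coprimez v4 g); last first.
  have hg : (gcdz v4 g %| g)%Z by exact: dvdz_gcdr.
  have hv1 := dvdz_trans hg g1; have hv2 := dvdz_trans hg g2.
  have hv4 : (gcdz v4 g %| v4)%Z by exact: dvdz_gcdl.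
  left; apply: lonely4C34; apply: (lonely4_common3 R h4) => //.
  by have := nodiv _ h4; rewrite hv1 hv2 hv4 andbT.
have [a v1E] := dvdzP g1; have [b v2E] := dvdzP g2.
right; exists a, b; split=> //; try by rewrite mulrC.
apply/eqP/(mulIf (lt0r_neq0 g_gt0)).
by rewrite mul1r -{1}(gtz0_abs g_gt0) mulz_gcdl -v1E -v2E.
Qed.

(** * Third and fourth speeds congruent modulo g *)

(** For even [m] the pair (a, m) is enough, [b] being corrected by a shift of 1/2;
    for a = 2 modulo 4, s = 1/4 works.  Otherwise [a] is a multiple of 4 and,
    up to sign, b = m modulo 4, so that [quarter_shift] leaves only a condition
    on the runners of speeds [a] and [b - m].  In the remaining case m = b the
    distance ||b s|| must be exactly 1/4, which still leaves |b| values of a s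
    spaced by 1/|b|. *)
Lemma quarter_or_tight_even (R : realType) (a b m : int) : a != 0 ->
  (2 %| a)%Z -> ~~ (2 %| b)%Z -> coprimez a b ->
  (exists s : R, [/\ 1 / 4 <= dist_int (s * a%:~R), 1 / 4 <= dist_int (s * b%:~R)
     & dist_int (s * m%:~R) <= 1 / 4])
  \/ [/\ (4 %| a)%Z, `|b| = 1 & `|m| = 1].
Proof.
move=> a0 a2; wlog b_ge0 : b / 0 <= b.
  move=> wlg b2 ab; have [b0|b0] := leP 0 b; first exact: wlg.
  have [|||[s [sa sb sm]]|[a4 b1 m1]] := wlg (- b).
  - by clear -b0; lia.
  - by clear -b2; lia.
  - by rewrite coprimezN.
  - by left; exists s; rewrite intrN mulrN dist_intN in sb.
  - by right; rewrite normrN in b1.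
move=> b2 ab.
have [m2|m2] := boolP (2 %| m)%Z.
  have [s [sa sm]] := mixed_runners R m a0; left.
  have [sb|sb] := leP (1 / 4) (dist_int (s * b%:~R)); first by exists s.
  exists (s + 1 / 2).
  rewrite (dist_int_halfshift_even _ a2) (dist_int_halfshift_even _ m2).
  by rewrite dist_int_halfshift //; split=> //; lra.
have [a4|a4] := boolP (4 %| a)%Z; last first.
  left; exists (1 / 4); rewrite (dist_int_quarter_odd R b2) (dist_int_quarter_odd R m2).
  split=> //.
  exact: dist_int_quarter_2mod4.
wlog bm4 : m m2 / (4 %| b - m)%Z.
  move=> wlg; have [bm4|bm4] := boolP (4 %| b - m)%Z; first exact: wlg.
  have bNm : (4 %| b - - m)%Z by clear -b2 m2 bm4; lia.
  have mN2 : ~~ (2 %| - m)%Z by clear -m2; lia.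
  have [[s [sa sb]]|[_ b1]] := wlg _ mN2 bNm; last by rewrite normrN; right.
  by rewrite intrN mulrN dist_intN => sm; left; exists s.
have [bmE|bm_neq] := eqVneq b m; last first.
  have n0 : b - m != 0 by rewrite subr_eq0.
  have [s [sa sn]] := two_runners R a0 n0.
  have [|k [sb sm]] := quarter_shift b2 bm4 (lexx _) _ sn; first by lra.
  by left; exists (s + k%:~R / 4%:~R); rewrite dist_int_shift //; split=> //; lra.
have [b1|b1] := eqVneq b 1; first by right; rewrite -bmE b1.
have b0 : 0 < b by rewrite lt_neqAle b_ge0 andbT; apply: contraNneq b2 => <-.
have bR : b%:~R != 0 :> R by rewrite intr_eq0 lt0r_neq0.
have [a1 aE] := dvdzP a2; rewrite mulrC in aE.
have b_a1 : ~~ (b %| a1)%Z.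
  apply/negP => ba; have : (b %| gcdz a b)%Z by rewrite dvdz_gcd aE dvdz_mull ?dvdzz.
  by rewrite (eqP ab) dvdz1 => /eqP; clear -b0 b1; lia.
have [i far] := shift_lonely (1 / (4 * b%:~R) * a%:~R : R) b0 b_a1.
(* At these times b s = 1/4 + i/2. *)
left; rewrite -bmE; exists (1 / (4 * b%:~R) + i%:~R / (2 * b%:~R)).
have -> : (1 / (4 * b%:~R) + i%:~R / (2 * b%:~R)) * b%:~R = 1 / 4 * (2 * i + 1)%:~R :> R.
  by rewrite intrD intrM; field; exact: bR.
rewrite dist_int_quarter_odd; last by clear; lia.
split=> //; rewrite mulrDl {2}aE.
have -> // : i%:~R / (2 * b%:~R) * (2 * a1)%:~R = i%:~R * (a1%:~R / b%:~R) :> R.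
by rewrite intrM; field; exact: bR.
Qed.

Lemma quarter_or_tight (R : realType) (a b m : int) : a != 0 -> b != 0 ->
  coprimez a b ->
  [\/ exists s : R, [/\ 1 / 4 <= dist_int (s * a%:~R), 1 / 4 <= dist_int (s * b%:~R)
     & dist_int (s * m%:~R) <= 1 / 4],
     [/\ (4 %| a)%Z, `|b| = 1 & `|m| = 1]
   | [/\ (4 %| b)%Z, `|a| = 1 & `|m| = 1]].
Proof.
move=> a0 b0 ab.
have [a2|a2] := boolP (2 %| a)%Z; have [b2|b2] := boolP (2 %| b)%Z.
- have : (2 %| gcdz a b)%Z by rewrite dvdz_gcd a2.
  by rewrite (eqP ab).
- have [] := quarter_or_tight_even R m a0 a2 b2 ab; first by constructor 1.
  by constructor 2.
- rewrite coprimez_sym in ab.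
  have [[s [sa sb sm]]|] := quarter_or_tight_even R m b0 b2 a2 ab; last by constructor 3.
  by constructor 1; exists s.
constructor 1; have [m2|m2] := boolP (2 %| m)%Z.
  exists (1 / 2); have := dist_int_half_odd R a2; have := dist_int_half_odd R b2.
  by have := dist_int_half_even R m2; split; lra.
by exists (1 / 4); rewrite !dist_int_quarter_odd.
Qed.

(** With [x] the position of the runner of speed [v], the runner of speed [v + g] is
    at x + s.  So [x] has to be in [1/4, 3/4 - s], where x = (s v + N)/g. *)
Lemma lonely4_neighbours (R : realType) (g c v N : int) (s : R) : 0 < g -> coprimez v g ->
  1 / 4 <= dist_int s -> 1 / 4 <= dist_int (s * c%:~R) -> 0 <= s ->
  g%:~R / 4 <= s * v%:~R + N%:~R <= 3 * g%:~R / 4 - g%:~R * s ->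
  lonely4 R (g * c) g v (v + g).
Proof.
move=> g0 vg s_far sc_far s0 /andP[sv_ge sv_le].
have gR : 0 < g%:~R :> R by rewrite ltr0z.
have [k [l /(_ s) kl]] := @lift_residue R g v N g0 vg.
exists ((s + k%:~R) / g%:~R); rewrite dist_int_lift //.
have -> : (s + k%:~R) / g%:~R * (v + g)%:~R
    = (s + k%:~R) / g%:~R * v%:~R + s + k%:~R.
  by rewrite intrD; field; exact: lt0r_neq0.
rewrite dist_int_lift1 //.
have y_ge : 1 / 4 <= (s * v%:~R + N%:~R) / g%:~R by rewrite ler_pdivlMr //; lra.
have y_le : (s * v%:~R + N%:~R) / g%:~R <= 3 / 4 - s by rewrite ler_pdivrMr //; lra.
rewrite dist_intD1; set x := _ * v%:~R in kl *; split=> //.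
  by apply: (@dist_int_ge _ _ _ (- l)); rewrite intrN; lra.
by apply: (@dist_int_ge _ _ _ (- l)); rewrite intrN; lra.
Qed.

(** Here e = 1/(16k), and 4ks goes from k + 1/4 to k + 3/4. *)
Lemma first_window (R : realType) (k : int) : 0 < k -> exists e : R,
  [/\ 0 < e, e <= 1 / 16, k%:~R * e = 1 / 16 & forall s,
    1 / 4 + e <= s <= 1 / 4 + 3 * e -> 1 / 4 <= dist_int (s * (4 * k)%:~R)].
Proof.
move=> k0; have kR : 1 <= k%:~R :> R by rewrite -[1]/(1%:~R) ler_int; clear -k0; lia.
have [e ke] : exists e : R, k%:~R * e = 1 / 16.
  by exists (1 / 16 / k%:~R); rewrite mulrC divfK // gt_eqF //; lra.
have e0 : 0 < e by rewrite -(@pmulr_rgt0 _ k%:~R); lra.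
exists e; split=> //.
  have : 0 <= e * (k%:~R - 1) by rewrite mulr_ge0; lra.
  by lra.
move=> s /andP[s_ge s_le]; apply: (@quarter_window _ _ k) => //; rewrite intrM.
have : (1 / 4 + e) * k%:~R <= s * k%:~R by rewrite ler_wpM2r; lra.
have : s * k%:~R <= (1 / 4 + 3 * e) * k%:~R by rewrite ler_wpM2r; lra.
by lra.
Qed.

(** The aim is an [s] just above 1/4 for which v s is, modulo 1, in [0, 2 - 4s].  If
    the left end s = 1/4 + e of the window of [first_window] does not do, v s is
    slightly less than an integer [n], and s = n/v is still in the window. *)
Lemma lonely4_tight_pair4 (R : realType) (k v : int) : 0 < k -> ~~ (2 %| v)%Z ->
  lonely4 R (4 * (4 * k)) 4 v (v + 4).
Proof.
move=> k0; wlog v_ge : v / - 1 <= v.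
  move=> wlg v2; have [v_ge|v_lt] := leP (- 1) v; first exact: wlg.
  apply: lonely4N; apply: lonely4C34; apply: lonely4N.
  have := wlg (- (v + 4)); rewrite (_ : - (v + 4) + 4 = - v); last by ring.
  by apply; clear -v_lt v2; lia.
move=> v2; have cop := coprimez4 v2.
have [e [e0 e_le ke window]] := first_window R k0.
have target (s : R) (n : int) : 1 / 4 + e <= s <= 1 / 4 + 3 * e ->
    n%:~R <= s * v%:~R <= n%:~R + 2 - 4 * s -> lonely4 R (4 * (4 * k)) 4 v (v + 4).
  move=> s_win sn; apply: (@lonely4_neighbours R 4 (4 * k) v (1 - n) s) => //.
  - by apply: (@dist_int_ge _ _ _ 0); lra.
  - exact: window.
  - by lra.
  by rewrite intrB; lra.
(* Exchanging v with -(v + 4) leaves v = -1 as the only negative case. *)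
have [vE|v_neq] := eqVneq v (- 1).
  by apply: (@target (1 / 4 + e) (- 1)); rewrite ?vE; lra.
have v_gt0 : 0 < v by clear -v_ge v_neq v2; lia.
set n := Num.ceil ((1 / 4 + e) * v%:~R).
have /andP[n_gt n_ge] := ceil_itv ((1 / 4 + e) * v%:~R); rewrite -/n in n_gt n_ge.
have [good|bad] := leP ((1 / 4 + e) * v%:~R) (n%:~R + 1 - 4 * (1 / 4 + e)).
  apply: (@target (1 / 4 + e) (n - 1)); first by lra.
  by rewrite intrB in n_gt *; lra.
have [v1|v1] := eqVneq v 1.
  have n_gt0 : (0 < n)%R by rewrite -(ltr_int R); move: n_ge; rewrite v1; lra.
  have : (1 : R) <= n%:~R by rewrite -[1]/(1%:~R) ler_int; clear -n_gt0; lia.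
  by move: bad; rewrite v1; lra.
have vR : 3 <= v%:~R :> R by rewrite -[3]/(3%:~R) ler_int; clear -v1 v_gt0 v2; lia.
have vV : n%:~R / v%:~R * v%:~R = n%:~R :> R by rewrite divfK // gt_eqF //; lra.
have s_ge : 1 / 4 + e <= n%:~R / v%:~R by rewrite ler_pdivlMr; lra.
have s_le : n%:~R / v%:~R <= 1 / 4 + 3 * e.
  rewrite ler_pdivrMr; last lra.
  have : 0 <= e * (v%:~R - 3) by rewrite mulr_ge0; lra.
  by lra.
by apply: (@target (n%:~R / v%:~R) n); rewrite ?vV; lra.
Qed.

(** At s = 1/4 + 1/(16k) the gap of [gap_lonely] is 1/4 - 1/(16k), which is at least
    1/g but for g = 4 and for (g, k) = (5, 1). *)
Lemma lonely4_tight_pair (R : realType) (g k v : int) : 4 <= g -> 0 < k -> coprimez v g ->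
  lonely4 R (g * (4 * k)) g v (v + g).
Proof.
move=> g4 k0 vg; have g0 : 0 < g by clear -g4; lia.
have [gE|g_neq4] := eqVneq g 4.
  rewrite gE in vg *; apply: lonely4_tight_pair4 => //.
  apply/negP => v2; have : (2 %| gcdz v 4)%Z by rewrite dvdz_gcd v2.
  by rewrite (eqP vg).
have [e [e0 e_le ke window]] := first_window R k0.
have s_far : 1 / 4 <= dist_int (1 / 4 + e) by apply: (@dist_int_ge _ _ _ 0); lra.
have sk_far : 1 / 4 <= dist_int ((1 / 4 + e) * (4 * k)%:~R) by apply: window; lra.
have [/andP[/eqP g5 /eqP k1]|easy] := boolP ((g == 5) && (k == 1)).
  (* Here s = 5/16, and the positions of the runner of speed v are multiples of
     1/80; the arc [20/80, 35/80] contains 16 of these, one in each class modulo 16. *)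
  have [N NE] : exists N, 20 <= 5 * v + 16 * N <= 35.
    by exists ((35 - 5 * v) %/ 16)%Z; clear; lia.
  apply: (@lonely4_neighbours R g (4 * k) v N (1 / 4 + e)) => //; first by lra.
  have {ke} ke : e = 1 / 16 by move: ke; rewrite k1; lra.
  by move: NE; rewrite -!(ler_int R) g5 ke; lra.
have gR : (6%:~R : R) <= g%:~R \/ (5%:~R : R) <= g%:~R /\ (2%:~R : R) <= k%:~R.
  by rewrite !ler_int; clear -g4 k0 easy g_neq4; lia.
have inv_le (c : R) : 0 < c -> c <= g%:~R -> 1 / g%:~R <= c^-1.
  by move=> c0 cg; rewrite div1r lef_pV2 ?posrE //; apply: lt_le_trans cg.
have g_inv : 1 / g%:~R <= 1 / 4 - e.
  case: gR => [g6|[g5 k2]].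
    by have := inv_le _ _ g6; rewrite ltr0z => /(_ isT); move: e_le; clear; lra.
  have e32 : 0 <= e * (k%:~R - 2).
    by rewrite mulr_ge0 ?(ltW e0) //; move: k2; clear; lra.
  by have := inv_le _ _ g5; rewrite ltr0z => /(_ isT); move: e32 ke; clear; lra.
have [|kk [far1 far2]] := @gap_lonely R g v 1 (1 / 4 + e) g0 vg.
  rewrite mulr1; apply: le_trans (dist_int_le _ 0) _.
  by rewrite subr0 ger0_norm; lra.
exists ((1 / 4 + e + kk%:~R) / g%:~R); rewrite dist_int_lift //.
by rewrite mulr1 in far2; rewrite dist_int_lift1 //; split.
Qed.

Lemma lonely4_tight_pair_signed (R : realType) (g a b v m : int) : 4 <= g -> a != 0 ->
  coprimez v g -> (4 %| a)%Z -> `|b| = 1 -> `|m| = 1 ->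
  lonely4 R (g * a) (g * b) v (v + g * m).
Proof.
move=> g4; wlog a_gt0 : a / 0 < a.
  move=> wlg a0 vg a4 b1 m1; have [a_gt0|a_le0] := ltP 0 a; first exact: wlg.
  apply: lonely4N1; rewrite -mulrN; apply: wlg => //; clear -a0 a_le0 a4; lia.
move=> _ vg /dvdzP[k aE] b1 m1; have k0 : 0 < k by clear -aE a_gt0; lia.
suff tight : lonely4 R (g * a) g v (v + g * m).
  have [->|->] : b = 1 \/ b = - 1 by clear -b1; lia.
    by rewrite mulr1.
  by rewrite mulrN1; apply: lonely4N2; rewrite opprK.
rewrite aE mulrC [k * 4]mulrC mulrC.
have [->|->] : m = 1 \/ m = - 1 by clear -m1; lia.
  by rewrite mulr1; exact: lonely4_tight_pair.
rewrite mulrN1; apply: lonely4C34.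
have := lonely4_tight_pair R g4 k0 (_ : coprimez (v - g) g); rewrite subrK; apply.
rewrite coprimez_sym /coprimez addrC -mulN1r gcdzMDl.
by rewrite -/(coprimez _ _) coprimez_sym.
Qed.

Lemma lonely4_congruent (R : realType) (g a b v m : int) : 4 <= g -> a != 0 -> b != 0 ->
  coprimez a b -> coprimez v g -> lonely4 R (g * a) (g * b) v (v + g * m).
Proof.
move=> g4 a0 b0 ab vg; have g0 : 0 < g by clear -g4; lia.
have [[s [sa sb sm]]|[a4 b1 m1]|[b4 a1 m1]] := quarter_or_tight R m a0 b0 ab.
- have gap : dist_int (s * m%:~R) <= 1 / 2 - 1 / g%:~R.
    have : 1 / g%:~R <= 4^-1 :> R.
      by rewrite div1r lef_pV2 ?posrE ?ltr0z // -[4]/(4%:~R) ler_int.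
    lra.
  have [k [far1 far2]] := gap_lonely g0 vg gap.
  by exists ((s + k%:~R) / g%:~R); rewrite !dist_int_lift.
- exact: lonely4_tight_pair_signed.
by apply: lonely4C12; exact: lonely4_tight_pair_signed.
Qed.

(** * A common factor greater than three *)

(** The inverse of [v] sends [w] to a residue other than 0 and +-1, so that the steps
    of [walk_lonely] are at least 2/g; the half circle of lonely positions of
    the runner of speed [v] has room for g/2 - 1 steps, rounded down. *)
Lemma lonely4_unrelated (R : realType) (g a b v w : int) : 6 <= g ->
  a != 0 -> b != 0 -> coprimez v g ->
  ~~ (g %| w)%Z -> ~~ (g %| w - v)%Z -> ~~ (g %| w + v)%Z ->
  lonely4 R (g * a) (g * b) v w.
Proof.
move=> g6 a0 b0 vg gw gwv gwv'; have g0 : 0 < g by clear -g6; lia.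
have gR : 0 < g%:~R :> R by rewrite ltr0z.
have [s [sa sb]] := two_runners R a0 b0.
(* K steps fit in the lonely half circle and K steps of 2/g cover 1/2. *)
set K := (`|g|%N./2).-1.
have : (2 * (K%:Z + 1) <= g) && (g <= 4 * K%:Z) by rewrite /K; clear -g6; lia.
rewrite -!(ler_int R) !intrM intrD -[K%:Z%:~R]/(K%:R) => /andP[Kg gK].
have [u q uq|k [l [/andP[kl_ge kl_lt] far]]] := @walk_lonely R g v w K s (1 / 4) g0 vg.
  have uw_far e : ~~ (g %| w - e * v)%Z -> ~~ (g %| u * w - e)%Z.
    apply: contra => /dvdzP[c cE]; apply/dvdzP; exists (c * v + q * w).
    have -> : w - e * v = (u * w - e) * v + (1 - u * v) * w by ring.
    by rewrite cE -uq; ring.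
  have uw0 : ~~ (g %| u * w)%Z by rewrite -[u * w]subr0 uw_far // mul0r subr0.
  have uw1 : ~~ (g %| u * w - 1)%Z by rewrite uw_far // mul1r.
  have uwN1 : ~~ (g %| u * w + 1)%Z.
    by rewrite -[1 in X in _ + X]opprK uw_far // mulN1r opprK.
  apply: (@le_trans _ _ (K%:R * (2 / g%:~R))); last by rewrite ler_wpM2l // dist_int_frac2.
  by rewrite mulrA ler_pdivlMr //; lra.
exists ((s + k%:~R) / g%:~R); rewrite !dist_int_lift //; split=> //.
have K_le : (K%:R + 1) / g%:~R <= 1 / 2 :> R by rewrite ler_pdivrMr //; lra.
by apply: (@dist_int_ge _ _ _ (- l)); rewrite intrN; lra.
Qed.

(** When the first runner is at [x] the second one is at 2x + m s.  If m s is lonely,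
    then [x] may be anywhere in an arc of length 1/4 contained in [1/4, 3/4],
    and this is more than the spacing 1/5. *)
Lemma lonely4_double_residue (R : realType) (a b v m : int) :
  a != 0 -> b != 0 -> m != 0 -> ~~ (5 %| v)%Z ->
  lonely4 R (5 * a) (5 * b) v (2 * v + 5 * m).
Proof.
move=> a0 b0 m0 v5; have [s [sa sb /dist_int_gap[n]]] := three_runners R a0 b0 m0.
set th := s * _ => th_gap.
have v5' : coprimez v 5 by exact: coprimez_prime.
(* This makes 2x + th fall in [n + 5/4, n + 7/4] up to an even integer. *)
have [k [l kl]] := hit_interval s (5 / 8 - (th - n%:~R) / 2) (isT : 0 < 5 :> int) v5'.
exists ((s + k%:~R) / 5%:~R); rewrite !dist_int_lift //.
have -> : (s + k%:~R) / 5%:~R * (2 * v + 5 * m)%:~R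
    = 2 * ((s + k%:~R) / 5%:~R * v%:~R) + th + (k * m)%:~R.
  by rewrite /th intrD !intrM; field.
rewrite dist_intD1; set x := _ * v%:~R in kl *; split=> //.
  by apply: (@dist_int_ge _ _ _ (- l)); rewrite intrN; lra.
by apply: (@dist_int_ge _ _ _ (n + 1 - 2 * l)); rewrite !intrD intrN intrM; lra.
Qed.

(** Multiplication by 2 sends the class of +-v to that of +-2v modulo 5, and that of
    +-2v back to that of +-v.  So in the case g = 5 the third and fourth runners
    can be exchanged, which avoids the vanishing of the coefficient [m]. *)
Lemma lonely4_quotient_large (R : realType) (g a b v w : int) : 4 <= g ->
  a != 0 -> b != 0 -> v != 0 -> w != 0 -> coprimez a b ->
  coprimez v g -> coprimez w g -> lonely4 R (g * a) (g * b) v w.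
Proof.
move=> g4 a0 b0 v0 w0 ab vg wg.
have g_ndvd (x : int) : coprimez x g -> ~~ (g %| x)%Z.
  move=> /eqP xg; apply/negP => gx; have : (g %| gcdz x g)%Z by rewrite dvdz_gcd gx dvdzz.
  by rewrite xg dvdz1 => /eqP; clear -g4; lia.
have plus (x y : int) : coprimez x g -> (g %| y - x)%Z -> lonely4 R (g * a) (g * b) x y.
  move=> xg /dvdzP[m yE]; have -> : y = x + g * m by rewrite mulrC -yE addrC subrK.
  exact: lonely4_congruent.
have [gwv|gwv] := boolP (g %| w - v)%Z; first exact: plus.
have [gwv'|gwv'] := boolP (g %| w + v)%Z.
  by apply: lonely4N; apply: plus => //; rewrite -opprD dvdz_opp.
have [g6|g6] := leP 6 g.
  exact: lonely4_unrelated (g_ndvd _ wg) gwv gwv'.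
have g5 : g = 5.
  have [g4E|//] : g = 4 \/ g = 5 by clear -g4 g6; lia.
  have odd (x : int) : coprimez x g -> ~~ (2 %| x)%Z.
    move=> /eqP xg; apply/negP => x2; have : (2 %| gcdz x g)%Z by rewrite dvdz_gcd x2 g4E.
    by rewrite xg.
  by have := odd v vg; have := odd w wg; rewrite g4E in gwv gwv'; clear -gwv gwv'; lia.
rewrite {}g5 in vg wg plus g_ndvd gwv gwv' *.
have v5 := g_ndvd _ vg; have w5 := g_ndvd _ wg.
have double (x y m : int) : x != 0 -> ~~ (5 %| x)%Z -> ~~ (5 %| y)%Z ->
    y = 2 * x + 5 * m -> lonely4 R (5 * a) (5 * b) x y.
  move=> x0 x5 y5 yE; have [m0|m0] := eqVneq m 0; last first.
    by rewrite yE; exact: lonely4_double_residue.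
  apply: lonely4C34; apply: lonely4N.
  (* y = 2x gives -x = 2y - 5x. *)
  have -> : - x = 2 * y + 5 * (- x) by rewrite yE m0; ring.
  by apply: lonely4_double_residue; rewrite ?oppr_eq0.
have [[m wE]|[m wE]] : (exists m, w = 2 * v + 5 * m) \/ (exists m, - w = 2 * v + 5 * m).
  have [/dvdzP[m mE]|/dvdzP[m mE]] : (5 %| w - 2 * v)%Z \/ (5 %| - w - 2 * v)%Z.
    by clear -v5 w5 gwv gwv'; lia.
  - by left; exists m; clear -mE; lia.
  by right; exists m; clear -mE; lia.
- exact: (@double v w m).
by apply: lonely4N; apply: (@double v (- w) m) => //; clear -w5; lia.
Qed.

Lemma lonely4_large_factor (R : realType) (g v1 v2 v3 v4 : int) : 3 < g ->
  (g %| v1)%Z -> (g %| v2)%Z -> v1 != 0 -> v2 != 0 -> v3 != 0 -> v4 != 0 ->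
  (forall q, 1 < q -> ~~ [&& (q %| v1)%Z, (q %| v2)%Z, (q %| v3)%Z & (q %| v4)%Z]) ->
  lonely4 R v1 v2 v3 v4.
Proof.
move=> g3 g1 g2 v1_0 v2_0 v3_0 v4_0 nodiv.
have [//|[a [b [v1E v2E ab v3g v4g]]]] := pair_normal_form R v1_0 v2_0 v3_0 v4_0 nodiv.
have gG : (g %| gcdz v1 v2)%Z by rewrite dvdz_gcd g1.
have G0 : 0 < gcdz v1 v2 by rewrite lt_neqAle eq_sym gcdz_eq0 (negPf v1_0).
move: (gcdz v1 v2) v1E v2E v3g v4g gG G0 => G v1E v2E v3g v4g /dvdzP[c GE] G0.
have g_gt0 : 0 < g by clear -g3; lia.
have G4 : 4 <= G.
  have c0 : 0 < c by move: G0; rewrite GE pmulr_lgt0.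
  have : 0 <= (c - 1) * g by rewrite mulr_ge0 ?(ltW g_gt0) //; clear -c0; lia.
  by rewrite GE; clear -g3; lia.
rewrite v1E v2E; apply: lonely4_quotient_large => //.
- by apply: contraNneq v1_0 => a0; rewrite v1E a0 mulr0.
by apply: contraNneq v2_0 => b0; rewrite v2E b0 mulr0.
Qed.

(** * A common factor equal to three *)

(** Absolute values are taken because signs are changed freely along the proof. *)
Definition barely_lonely (a b c d : int) : Prop :=
  exists2 k : nat, (0 < k)%N &
    perm_eq [:: `|a|; `|b|; `|c|; `|d|]%N [:: 1; 2; 3; 12 * k]%N.

Definition lonely_or_barely (R : realType) (a b c d : int) : Prop :=
  lonely4 R a b c d \/ barely_lonely a b c d.

Lemma lonely_or_barelyC12 (R : realType) (a b c d : int) :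
  lonely_or_barely R b a c d -> lonely_or_barely R a b c d.
Proof.
case=> [lon|[k k0 p]]; [left; exact: lonely4C12|right; exists k => //].
by apply: perm_trans p; apply/permP => x /=; rewrite addnCA.
Qed.

Lemma lonely_or_barelyC34 (R : realType) (a b c d : int) :
  lonely_or_barely R a b d c -> lonely_or_barely R a b c d.
Proof.
case=> [lon|[k k0 p]]; [left; exact: lonely4C34|right; exists k => //].
by apply: perm_trans p; apply/permP => x /=; lia.
Qed.

Lemma lonely_or_barelyN2 (R : realType) (a b c d : int) :
  lonely_or_barely R a (- b) c d -> lonely_or_barely R a b c d.
Proof.
by case=> [lon|]; rewrite /barely_lonely ?abszN; [left; exact: lonely4N2|right].
Qed.

Lemma lonely_or_barelyN (R : realType) (a b c d : int) :
  lonely_or_barely R a b c (- d) -> lonely_or_barely R a b c d.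
Proof.
by case=> [lon|]; rewrite /barely_lonely ?abszN; [left; exact: lonely4N|right].
Qed.

(** Lonely times t = j/12 with [j] odd: the first two runners are then at odd
    multiples of 1/4 or at 1/2, and the others only depend on the residues
    modulo 12. *)
Lemma lonely4_twelfths (R : realType) (a b v w : int) :
  ~~ (4 %| a)%Z -> ~~ (4 %| b)%Z -> ~~ (3 %| v)%Z -> ~~ (3 %| w)%Z -> ~~ (2 %| v + w)%Z ->
  lonely4 R (3 * a) (3 * b) v w.
Proof.
move=> a4 b4; wlog v2 : v w / ~~ (2 %| v)%Z.
  move=> wlg v3 w3 vw; have [v2|v2] := boolP (2 %| v)%Z; last exact: wlg.
  by apply: lonely4C34; apply: wlg => //; clear -v2 vw; lia.
move=> v3 w3 vw; have [j [n1 [n2 [j2 [h1 h2] [h3 h4]]]]] : exists j n1 n2 : int, [/\ ~~ (2 %| j)%Z,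
    12 * n1 + 3 <= v * j /\ v * j <= 12 * n1 + 9
    & 12 * n2 + 3 <= w * j /\ w * j <= 12 * n2 + 9].
  (* If 4 does not divide w, j = 3 puts v j and w j at 3, 6 or 9 modulo 12.  If it
     does, w j is 4 or 8 modulo 12 and j in {1, 5} can be chosen for v alone. *)
  have [w4|w4] := boolP (4 %| w)%Z; last first.
    exists 3, (v * 3 %/ 12)%Z, (w * 3 %/ 12)%Z.
    by clear -v2 vw w4; split=> //; lia.
  have [v5|v5] := boolP ((12 %| v - 5)%Z || (12 %| v - 7)%Z).
    by exists 1, (v %/ 12)%Z, (w %/ 12)%Z; clear -v5 w4 w3; split=> //; lia.
  by exists 5, (v * 5 %/ 12)%Z, (w * 5 %/ 12)%Z; clear -v2 v3 v5 w4 w3; split=> //; lia.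
have quarter (c : int) : ~~ (4 %| c)%Z -> 1 / 4 <= dist_int (j%:~R / 12%:~R * (3 * c)%:~R : R).
  move=> c4; have -> : j%:~R / 12%:~R * (3 * c)%:~R = (c * j)%:~R / 4%:~R :> R.
    by rewrite !intrM; field.
  have cj4 : ~~ (4 %| c * j)%Z.
    have j4 : coprimez 4 j by rewrite coprimez_sym; exact: coprimez4.
    by rewrite Gauss_dvdzl.
  by have := dist_int_frac R (isT : 0 < 4 :> int) cj4; lra.
exists (j%:~R / 12%:~R); split; [exact: quarter|exact: quarter| |];
  rewrite mulrAC -intrM mulrC; [rewrite [j * v]mulrC|rewrite [j * w]mulrC].
  by rewrite mulrC; apply: (@dist_int_ratio _ _ _ n1) => //; clear -h1 h2; lia.
by rewrite mulrC; apply: (@dist_int_ratio _ _ _ n2) => //; clear -h3 h4; lia.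
Qed.

Lemma lonely4_third_gap (R : realType) (a b v m : int) (s : R) : ~~ (3 %| v)%Z ->
  1 / 4 <= dist_int (s * a%:~R) -> 1 / 4 <= dist_int (s * b%:~R) ->
  dist_int (s * m%:~R) <= 1 / 6 -> lonely4 R (3 * a) (3 * b) v (v + 3 * m).
Proof.
move=> v3 sa sb sm; have v3' : coprimez v 3 by exact: coprimez_prime.
have sm' : dist_int (s * m%:~R) <= 1 / 2 - 1 / 3%:~R by lra.
have [k [far1 far2]] := gap_lonely (isT : 0 < 3 :> int) v3' sm'.
by exists ((s + k%:~R) / 3%:~R); rewrite !dist_int_lift.
Qed.

(** Impose that the first runner is at 1/4 at the time t: then t is determined up to
    multiples of 1/(3a), in particular t = (1/a + k)/12 is allowed for all [k].
    The last runner is 1/4 ahead of the third, which has to be in [1/4, 1/2].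
    This arc contains three consecutive points of its coset of (1/12)Z, and in
    two steps of an odd multiple of 1/4 the second runner gets lonely. *)
Lemma lonely4_sum_even (R : realType) (a b v : int) : a != 0 ->
  (4 %| a)%Z -> ~~ (2 %| b)%Z -> ~~ (2 %| v)%Z -> ~~ (3 %| v)%Z ->
  lonely4 R (3 * a) (3 * b) v (v + 3 * a).
Proof.
move=> a0 a4 b2 v2 v3; have aR : a%:~R != 0 :> R by rewrite intr_eq0.
have v12 : coprimez v 12.
  by rewrite (_ : 12 = 4 * 3) // coprimezMr coprimez4 //= coprimez_prime.
have [u q uq|k [l [/andP[kl_ge kl_lt] far]]] :=
    @walk_lonely R 12 v (3 * b) 2 (1 / a%:~R) (1 / 4) isT v12.
  have ub4 : ~~ (4 %| u * b)%Z.
    have u2 : ~~ (2 %| u)%Z.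
      apply/negP => /dvdzP[c uE]; move: uq; rewrite uE; clear; lia.
    have b4 : coprimez 4 b by rewrite coprimez_sym; exact: coprimez4.
    rewrite Gauss_dvdzl //; apply: contra u2 => /dvdzP[c ->]; clear; lia.
  have -> : (u * (3 * b))%:~R / 12%:~R = (u * b)%:~R / 4%:~R :> R.
    by rewrite !intrM; field.
  by have := dist_int_frac R (isT : 0 < 4 :> int) ub4; lra.
have [c ac] := dvdzP a4.
have v1E : (1 / a%:~R + k%:~R) / 12%:~R * (3 * a)%:~R = 1 / 4 + (k * c)%:~R :> R.
  have -> : (1 / a%:~R + k%:~R) / 12%:~R * (3 * a)%:~R
      = 1 / 4 + k%:~R * a%:~R / 4 :> R by rewrite intrM; field; exact: aR.
  by rewrite ac !intrM; field.
exists ((1 / a%:~R + k%:~R) / 12%:~R); split=> //.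
- by rewrite v1E dist_intD1; apply: (@dist_int_ge _ _ _ 0); lra.
- by apply: (@dist_int_ge _ _ _ (- l)); rewrite intrN; lra.
rewrite intrD mulrDr v1E addrA dist_intD1.
by apply: (@dist_int_ge _ _ _ (- l)); rewrite intrN; lra.
Qed.

(** Impose that the second runner is at 1/4.  The last one is then 1/4 ahead of the
    third, whose positions in [1/4, 1/2] are spaced by 1/(3b); meanwhile the first
    one moves in steps which are nonzero multiples of 1/b, and (b + 1)/2 of them
    suffice.  If [v] is not prime to 3b, the second, third and fourth speeds have
    a common factor. *)
Lemma lonely4_sum_odd (R : realType) (a b v : int) : 5 <= b -> ~~ (2 %| b)%Z ->
  a != 0 -> coprimez a b -> ~~ (3 %| v)%Z -> v != 0 -> v + 3 * b != 0 ->
  lonely4 R (3 * a) (3 * b) v (v + 3 * b).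
Proof.
move=> b5 b2 a0 ab v3 v0 w0.
have b0 : 0 < b by clear -b5; lia.
have g0 : 0 < 3 * b by clear -b5; lia.
have v3' : coprimez v 3 by exact: coprimez_prime.
have [vg|vg] := boolP (coprimez v (3 * b)); last first.
  set h := gcdz v (3 * b).
  have h1 : 1 < h.
    have : h != 1 by [].
    have : 0 < h by rewrite lt_neqAle eq_sym gcdz_eq0 (negPf v0).
    by clear; lia.
  have hv : (h %| v)%Z by exact: dvdz_gcdl.
  have hb : (h %| 3 * b)%Z by exact: dvdz_gcdr.
  have ha : ~~ (h %| 3 * a)%Z.
    apply/negP => ha; have : (h %| gcdz (3 * a) (3 * b))%Z by rewrite dvdz_gcd ha.
    rewrite -mulz_gcdr (eqP ab) mulr1 => h3.
    have : (h %| gcdz v 3)%Z by rewrite dvdz_gcd hv.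
    by rewrite (eqP v3') dvdz1 => /eqP; clear -h1; lia.
  have hw : (h %| v + 3 * b)%Z.
    have [x xE] := dvdzP hv; have [y yE] := dvdzP hb.
    by apply/dvdzP; exists (x + y); rewrite [RHS]mulrDl -xE -yE.
  apply: lonely4_swap; apply: lonely4C34; apply: (lonely4_common3 R h1 hv hw hb ha) => //.
  by rewrite gt_eqF.
have bR : 0 < b%:~R :> R by rewrite ltr0z.
have bN0 : b%:~R != 0 :> R by rewrite gt_eqF.
set K := (`|b|%N.+1)./2.
have : 2 * K%:Z = b + 1 by rewrite /K; clear -b5 b2; lia.
move/(congr1 (fun n : int => n%:~R : R)); rewrite intrM intrD -[K%:Z%:~R]/(K%:R) => KE.
have [u q uq|k [l [/andP[kl_ge kl_lt] far]]] :=
    @walk_lonely R (3 * b) v (3 * a) K (1 / 4) (1 / 4) g0 vg.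
  have -> : (u * (3 * a))%:~R / (3 * b)%:~R = (u * a)%:~R / b%:~R :> R.
    by rewrite !intrM; field.
  have bu : coprimez b u.
    by rewrite coprimez_sym; apply/coprimezP; exists (v, q * 3); rewrite /= -[RHS]uq; ring.
  have b_ua : ~~ (b %| u * a)%Z.
    rewrite Gauss_dvdzr //; apply/negP => ba.
    have : (b %| gcdz a b)%Z by rewrite dvdz_gcd ba dvdzz.
    by rewrite (eqP ab) dvdz1 => /eqP; clear -b5; lia.
  apply: (@le_trans _ _ (K%:R * (1 / b%:~R))); last by rewrite ler_wpM2l // dist_int_frac.
  by rewrite mulrA ler_pdivlMr //; lra.
set t : R := (1 / 4 + k%:~R) / (3 * b)%:~R.
have v2E : t * (3 * b)%:~R = 1 / 4 + k%:~R by rewrite divfK // intr_eq0 gt_eqF.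
set N := (1 + 4 * k) * v + 12 * b * l.
have xE : t * v%:~R + l%:~R = N%:~R / (12 * b%:~R).
  by rewrite /t /N !(intrD, intrM); field.
(* The position of the third runner is a multiple N/(12b); integrality of N
   turns the strict bound of the walk into the bound 1/2. *)
have N_lt : N < 5 * b + 6.
  move: kl_lt; rewrite -/t xE -(ltr_int R) ltr_pdivrMr ?mulr_gt0 //.
  rewrite mulrDl intrM.
  have -> : (K%:R + 1) / (3%:~R * b%:~R) * (12 * b%:~R) = 4 * (K%:R + 1) :> R by field.
  by rewrite intrD intrM; lra.
have N_le : t * v%:~R + l%:~R <= 1 / 2.
  rewrite xE ler_pdivrMr ?mulr_gt0 //.
  have : N <= 6 * b by clear -N_lt b5; lia.
  by rewrite -(ler_int R) intrM; lra.
rewrite -/t in kl_ge; exists t; split=> //.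
- by rewrite v2E dist_intD1; apply: (@dist_int_ge _ _ _ 0); lra.
- by apply: (@dist_int_ge _ _ _ (- l)); rewrite intrN; lra.
rewrite intrD mulrDr v2E addrA dist_intD1.
by apply: (@dist_int_ge _ _ _ (- l)); rewrite intrN; lra.
Qed.

(** For b = 3 the arc considered in [lonely4_sum_odd] has too few points.  Take
    t = j/36 with j = 1 modulo 4 and [j] prime to 3: the first runner is at +-1/3,
    the second at 1/4, and v j must be in [9, 18] modulo 36; the residues modulo
    36 are finitely many. *)
Lemma lonely4_sum_nine (R : realType) (a v : int) : (4 %| a)%Z -> ~~ (3 %| a)%Z ->
  ~~ (3 %| v)%Z -> lonely4 R (3 * a) (3 * 3) v (v + 3 * 3).
Proof.
move=> a4 a3 v3.
have [j [n [j4 j3 n_le le_n]]] : exists j n : int,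
    [/\ (4 %| j - 1)%Z, ~~ (3 %| j)%Z, 36 * n + 9 <= v * j & v * j <= 36 * n + 18].
  have table : all (fun r => (3 %| r)%N || has (fun j : nat => [&& (j %% 4 == 1)%N,
     ~~ (3 %| j)%N, (9 <= (r * j) %% 36)%N & ((r * j) %% 36 <= 18)%N]) (iota 0 36)) (iota 0 36).
    by vm_compute.
  have [r [q [vE r36]]] : exists (r : nat) (q : int), v = 36 * q + r%:Z /\ (r < 36)%N.
    by exists `|(v %% 36)%Z|%N, (v %/ 36)%Z; clear; lia.
  have /(allP table)/orP[r3|/hasP[j _ /and4P[j4 j3 j_ge j_le]]] : r \in iota 0 36.
  - by rewrite mem_iota.
  - by exfalso; clear -vE r3 v3; lia.
  have rj : r%:Z * j%:Z = ((r * j) %/ 36)%N%:Z * 36 + ((r * j) %% 36)%N%:Z.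
    by rewrite -!PoszM -PoszD -divn_eq.
  exists j%:Z, (q * j%:Z + ((r * j) %/ 36)%N%:Z); rewrite vE; split.
  - by clear -j4; lia.
  - by clear -j3; lia.
  - move: rj j_ge; set d := (_ %/ _)%N; set e := (_ %% _)%N; clear; lia.
  move: rj j_le; set d := (_ %/ _)%N; set e := (_ %% _)%N; clear; lia.
have [c aE] := dvdzP a4.
have cj3 : ~~ (3 %| c * j)%Z.
  have j3' : coprimez 3 j by rewrite coprimez_sym; exact: coprimez_prime.
  rewrite Gauss_dvdzl //; apply: contra a3; rewrite aE; clear; lia.
have [i jE] : exists i, j = 4 * i + 1 by exists ((j - 1) %/ 4)%Z; clear -j4; lia.
exists (j%:~R / 36%:~R); split.
- have -> : j%:~R / 36%:~R * (3 * a)%:~R = (c * j)%:~R / 3%:~R :> R.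
    by rewrite aE !intrM; field.
  by have := dist_int_frac R (isT : 0 < 3 :> int) cj3; lra.
- have -> : j%:~R / 36%:~R * (3 * 3)%:~R = 1 / 4 + i%:~R :> R.
    by rewrite jE intrD !intrM; field.
  by rewrite dist_intD1; apply: (@dist_int_ge _ _ _ 0); lra.
- have -> : j%:~R / 36%:~R * v%:~R = (v * j)%:~R / 36%:~R :> R by rewrite intrM; field.
  by apply: (@dist_int_ratio _ _ _ n) => //; clear -n_le le_n; lia.
have -> : j%:~R / 36%:~R * (v + 3 * 3)%:~R = (v * j + 9)%:~R / 36%:~R + i%:~R :> R.
  by rewrite jE !(intrD, intrM); field.
by rewrite dist_intD1; apply: (@dist_int_ratio _ _ _ n) => //; clear -n_le le_n; lia.
Qed.

(** The intervals on which 4ks is within 1/4 of an integer have length 1/(8k). *)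
Lemma quarter_in_interval (R : realType) (k : int) (L U : R) : 0 < k ->
  L + (8 * k%:~R)^-1 <= U ->
  exists2 s, L <= s <= U & 1 / 4 <= dist_int (s * (4 * k)%:~R).
Proof.
move=> k0; have kR : 1 <= k%:~R :> R by rewrite -[1]/(1%:~R) ler_int; clear -k0; lia.
move=> LU; have k4 : (4 * k)%:~R = 4 * k%:~R :> R by rewrite intrM.
have k8 : (8 * k%:~R)^-1 * (8 * k%:~R) = 1 :> R by rewrite mulVf // gt_eqF //; lra.
move: (8 * k%:~R)^-1 k8 LU => e k8 LU.
have e0 : 0 < e by rewrite -(@pmulr_lgt0 _ (8 * k%:~R)); lra.
have [L_far|L_near] := leP (1 / 4) (dist_int (L * (4 * k)%:~R)).
  by exists L; lra.
have [n] := dist_int_near (L * (4 * k)%:~R).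
move: (dist_int _) L_near => d d_lt Ln.
have [s sE] : exists s : R, s * (4 * k)%:~R = n%:~R + 1 / 4.
  by exists ((n%:~R + 1 / 4) / (4 * k)%:~R); rewrite divfK // k4 gt_eqF //; lra.
exists s; last by apply: (@quarter_window _ _ n); rewrite // sE; lra.
rewrite k4 in sE Ln; apply/andP; split.
  by rewrite -(@ler_pM2r _ (4 * k%:~R)); lra.
apply: le_trans LU; rewrite -(@ler_pM2r _ (4 * k%:~R)); lra.
Qed.

(** With t = (s + j)/3, loneliness of the last two runners means that v s + 1/4 is at
    least, and (v + 3) s - 5/4 at most, some integer [n].  If v >= 2k + 2, then v s
    moves fast enough to meet this condition while [s] remains in
    [1/4 + 1/(16k), 1/4 + 3/(16k)].  If v <= 2k + 1, one of the intervals of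
    values of [s] above 1/4 allowed for a fixed [n] has length at least 1/(8k),
    and [quarter_in_interval] applies, apart from v = 1 and from the pairs
    (v, k) = (2, 1) and (5, 2), for which [s] is given explicitly. *)
Lemma tight_pair3_time (R : realType) (k v : int) : 0 < k -> 0 < v ->
  exists (s : R) (n : int), [/\ 1 / 4 <= s <= 1 / 2, 1 / 4 <= dist_int (s * (4 * k)%:~R)
    & n%:~R - 1 / 4 <= s * v%:~R /\ s * (v%:~R + 3) <= n%:~R + 5 / 4].
Proof.
move=> k0 v0.
have vR : 1 <= v%:~R :> R by rewrite -[1]/(1%:~R) ler_int; clear -v0; lia.
have [e [e0 e_le ke window]] := first_window R k0.
have [v1|v1] := eqVneq v 1.
  by exists (1 / 4 + e), 0; rewrite v1; split; [lra|apply: window; lra|lra].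
have [v_big|v_small] := leP (2 * k + 2) v.
  have vkR : 2 * k%:~R + 2 <= v%:~R :> R.
    by move: v_big; rewrite -(ler_int R) intrD intrM.
  (* The last integer n compatible with the third runner at the left end. *)
  set n := Num.floor ((1 / 4 + e) * v%:~R + 1 / 4).
  have /andP[n_le n_gt] := floor_itv ((1 / 4 + e) * v%:~R + 1 / 4).
  rewrite -/n intrD in n_le n_gt.
  have [good|bad] := leP ((1 / 4 + e) * (v%:~R + 3)) (n%:~R + 5 / 4).
    by exists (1 / 4 + e), n; split; [lra|apply: window; lra|lra].
  have v_gt0 : 0 < v%:~R :> R by lra.
  (* Otherwise wait until the third runner allows the next integer, n + 1. *)
  have [s sv] : exists s : R, s * v%:~R = n%:~R + 3 / 4.
    by exists ((n%:~R + 3 / 4) / v%:~R); rewrite divfK // gt_eqF.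
  have s_ge : 1 / 4 + e <= s by rewrite -(ler_pM2r v_gt0); lra.
  have s_le : s <= 1 / 4 + 3 * e.
    rewrite -(ler_pM2r v_gt0).
    have : 0 <= e * (v%:~R - 2 * k%:~R - 2).
      by rewrite mulr_ge0 ?(ltW e0) //; clear -vkR; lra.
    clear -bad sv ke e0; lra.
  by exists s, (n + 1); split; [lra|apply: window; lra|rewrite intrD; lra].
have [/andP[/eqP v2 /eqP k1]|not2] := boolP ((v == 2) && (k == 1)).
  exists (3 / 8), 1; rewrite v2 k1; split; [lra| |lra].
  by apply: (@quarter_window _ _ 1); rewrite // intrM; lra.
have [/andP[/eqP v5 /eqP k2]|not5] := boolP ((v == 5) && (k == 2)).
  exists (13 / 32), 2; rewrite v5 k2; split; [lra| |lra].
  by apply: (@quarter_window _ _ 3); rewrite // intrM; lra.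
have v_gt0 : 0 < v%:~R :> R by lra.
have v3_gt0 : 0 < v%:~R + 3 :> R by lra.
have k_gt0 : 0 < 8 * k%:~R :> R by rewrite mulr_gt0 // ltr0z.
have long (L U : R) (n : int) : 1 / 4 <= L -> U <= 1 / 2 ->
    n%:~R - 1 / 4 <= L * v%:~R -> U * (v%:~R + 3) <= n%:~R + 5 / 4 ->
    1 <= (U - L) * (8 * k%:~R) ->
    exists (s : R) (n : int), [/\ 1 / 4 <= s <= 1 / 2, 1 / 4 <= dist_int (s * (4 * k)%:~R)
      & n%:~R - 1 / 4 <= s * v%:~R /\ s * (v%:~R + 3) <= n%:~R + 5 / 4].
  move=> L_ge U_le Ln Un LU.
  have [|s /andP[Ls sU] far] := @quarter_in_interval R k L U k0.
    by rewrite addrC -lerBrDr -div1r ler_pdivrMr.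
  exists s, n; split=> //; first by apply/andP; split; lra.
  by split; [apply: le_trans Ln _|apply: le_trans Un]; rewrite ler_wpM2r // ltW.
(* For v = 4j the allowed interval is cut at 1/4.  Otherwise n is the least
   integer such that the whole interval is above 1/4, and e1 = 4n - v - 1. *)
have [v4|v4] := boolP (4 %| v)%Z.
  have [j vE] := dvdzP v4; have vER : v%:~R = j%:~R * 4 :> R by rewrite vE intrM.
  have vkR : v%:~R + 3 <= 4 * k%:~R :> R.
    have : v + 3 <= 4 * k by lia.
    by rewrite -(ler_int R); lra.
  apply: (long (1 / 4) ((j%:~R + 5 / 4) / (v%:~R + 3)) j); rewrite ?divfK ?gt_eqF //.
  - by rewrite ler_pdivrMr //; lra.
  - by lra.
  have -> : (j%:~R + 5 / 4) / (v%:~R + 3) - 1 / 4 = (1 / 2) / (v%:~R + 3) :> R.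
    by rewrite vER; field; rewrite -vER gt_eqF.
  by rewrite mulrAC ler_pdivlMr //; lra.
have [n [e1 [nE e1_ge e1_le big]]] : exists n e1 : int,
    [/\ 4 * n = v + 1 + e1, 0 <= e1, e1 <= v & v * (v + 3) <= 6 * k * (v - e1)].
  exists ((v + 4) %/ 4)%Z, (4 * ((v + 4) %/ 4)%Z - v - 1); split; first by ring.
  - by clear; lia.
  - by clear -v1 v0 v4; lia.
  have k_large (x : int) : x <= v -> 0 <= (2 * k - (v - 1)) * (v - x).
    by move=> xv; rewrite mulr_ge0 // subr_ge0 //; clear -v_small; lia.
  have v_large (x : int) : x <= v -> 0 <= (v - x) * v.
    by move=> xv; rewrite mulr_ge0 // ?subr_ge0 // ltW.
  have [[-> v3]|[[-> v2]|[-> v5]]] : (4 * ((v + 4) %/ 4)%Z - v - 1 = 0 /\ 3 <= v) \/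
      (4 * ((v + 4) %/ 4)%Z - v - 1 = 1 /\ (v == 2) || (6 <= v)) \/
      (4 * ((v + 4) %/ 4)%Z - v - 1 = 2 /\ (v == 5) || (9 <= v)).
  - by clear -v1 v0 v4; lia.
  - by have := k_large 0 (ltW v0); have := v_large 3 v3; clear; lia.
  - case/orP: v2 => [/eqP v2|v6]; first by move: not2; rewrite v2; clear -k0; lia.
    by have := v_large 6 v6; have := k_large 1 v0; clear -v6; lia.
  case/orP: v5 => [/eqP v5|v9]; first by move: not5 v_small; rewrite v5; clear; lia.
  have v2 : 2 <= v by clear -v9; lia.
  by have := v_large 9 v9; have := k_large 2 v2; clear -v9; lia.
have nER : n%:~R = (v%:~R + 1 + e1%:~R) / 4 :> R.
  have := congr1 (fun m : int => m%:~R : R) nE; rewrite /= !intrD intrM; lra.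
have bigR : v%:~R * (v%:~R + 3) <= 6 * k%:~R * (v%:~R - e1%:~R) :> R.
  by move: big; rewrite -(ler_int R); clear; lra.
have e1R : 0 <= e1%:~R :> R /\ e1%:~R <= v%:~R :> R.
  by move: e1_ge e1_le; rewrite -!(ler_int R); clear; lra.
apply: (long ((n%:~R - 1 / 4) / v%:~R) ((n%:~R + 5 / 4) / (v%:~R + 3)) n);
  rewrite ?divfK ?gt_eqF //.
- by rewrite ler_pdivlMr //; lra.
- by rewrite ler_pdivrMr //; lra.
have -> : (n%:~R + 5 / 4) / (v%:~R + 3) - (n%:~R - 1 / 4) / v%:~R =
    3 / 4 * (v%:~R - e1%:~R) / (v%:~R * (v%:~R + 3)) :> R.
  by rewrite nER; field; rewrite !gt_eqF.
by rewrite mulrAC ler_pdivlMr ?mulr_gt0 //; lra.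
Qed.

Lemma lonely4_tight_pair3 (R : realType) (k v : int) : 0 < k -> ~~ (3 %| v)%Z ->
  v != - 1 -> v != - 2 -> lonely4 R (3 * (4 * k)) 3 v (v + 3).
Proof.
move=> k0; wlog v_gt0 : v / 0 < v.
  move=> wlg v3 v_1 v_2; have [v_gt0|v_le0] := ltP 0 v; first exact: wlg.
  apply: lonely4N; apply: lonely4C34; apply: lonely4N.
  have := wlg (- (v + 3)); rewrite (_ : - (v + 3) + 3 = - v); last by ring.
  by apply; clear -v_le0 v_1 v_2 v3; lia.
move=> v3 _ _; have cop : coprimez v 3 by exact: coprimez_prime.
have [s [n [s_win sk_far [sv_ge sv_le]]]] := tight_pair3_time R k0 v_gt0.
apply: (@lonely4_neighbours R 3 (4 * k) v (1 - n) s) => //; last by rewrite intrB; lra.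
  by apply: (@dist_int_ge _ _ _ 0); lra.
lra.
Qed.

(** For even [m], [runners_sixth] gives an [s] and a shift by 1/2 takes care of [b],
    unless m = +-a, where the last speed is the sum of two others.  For odd [m]
    and 4 not dividing [a] there is a lonely multiple of 1/12.  Otherwise b = m
    modulo 4, up to sign, and [quarter_shift] works as soon as the difference
    [b - m] is nonzero; if m = b, the last speed is again a sum of two others. *)
Lemma quotient_three_even (R : realType) (a b v m : int) : a != 0 -> b != 0 ->
  (2 %| a)%Z -> ~~ (2 %| b)%Z -> coprimez a b ->
  ~~ (3 %| v)%Z -> v != 0 -> v + 3 * m != 0 ->
  lonely_or_barely R (3 * a) (3 * b) v (v + 3 * m).
Proof.
move=> a0 b0 a2 b2 ab.
have difference x : ~~ (3 %| x)%Z -> x != 0 -> x + 3 * a != 0 ->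
    lonely4 R (3 * a) (3 * b) x (x + 3 * a).
  move=> x3 x0 y0; have [x2|x2] := boolP (2 %| x)%Z.
    have a6 : (2 %| 3 * a)%Z by rewrite dvdz_mull.
    have y2 : (2 %| x + 3 * a)%Z by move: x2 a2; clear; lia.
    have b6 : ~~ (2 %| 3 * b)%Z by move: b2; clear; lia.
    have a60 : 3 * a != 0 by move: a0; clear; lia.
    apply: lonely4_swap; apply: lonely4C34.
    have [t [? ? ? ?]] := lonely4_common3 R (isT : 1 < 2 :> int) x2 y2 a6 b6 x0 y0 a60.
    by exists t.
  have [a4|a4] := boolP (4 %| a)%Z; first exact: lonely4_sum_even.
  exists (1 / 4); split; [apply: dist_int_quarter_2mod4|rewrite dist_int_quarter_odd //..];
    by move: a2 b2 x2 a4; clear; lia.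
have [m2|m2] := boolP (2 %| m)%Z.
  move=> v3 v0 w0; left.
  have [mE|m_neqN] := eqVneq m (- a).
    have vE : v + 3 * m + 3 * a = v by rewrite mE; ring.
    apply: lonely4C34; rewrite -{2}vE; apply: difference; rewrite ?vE //.
    by move: v3; clear; lia.
  have [mE|m_neq] := eqVneq m a; first by rewrite {}mE in w0 *; apply: difference.
  have [s [sa sm]] := runners_sixth R a0 m_neq m_neqN.
  have [sb|sb] := leP (1 / 4) (dist_int (s * b%:~R)); first exact: lonely4_third_gap sm.
  apply: (@lonely4_third_gap _ _ _ _ _ (s + 1 / 2)) => //.
  - by rewrite dist_int_halfshift_even.
  - by rewrite dist_int_halfshift //; lra.
  by rewrite dist_int_halfshift_even.
clear difference.
have [a4|a4] := boolP (4 %| a)%Z; last first.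
  move=> v3 v0 w0; left; apply: lonely4_twelfths => //; move: b2 v3 m2; clear; lia.
wlog bm4 : b b0 b2 ab / (4 %| b - m)%Z.
  move=> wlg v3 v0 w0; have [bm4|bm4] := boolP (4 %| b - m)%Z; first exact: wlg.
  apply: lonely_or_barelyN2; rewrite -mulrN.
  have := wlg (- b); rewrite oppr_eq0 dvdz_opp coprimezN; apply=> //.
  by move: b2 m2 bm4; clear; lia.
have [mb|mb] := eqVneq m b; last first.
  move=> v3 v0 w0; left.
  have n0 : b - m != 0 by rewrite subr_eq0 eq_sym.
  have [s [sa sn]] := two_runners_third R a0 n0.
  have c4 : 1 / 4 <= 1 / 3 :> R by lra.
  have [k [sb sm]] := quarter_shift b2 bm4 c4 (lexx _) sn.
  apply: (@lonely4_third_gap _ _ _ _ _ (s + k%:~R / 4%:~R)) => //; last by lra.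
  by rewrite dist_int_shift //; lra.
rewrite mb; clear m mb m2 bm4.
wlog b_gt0 : b v b0 b2 ab / 0 < b.
  move=> wlg v3 v0 w0; have [b_gt0|b_le0] := ltP 0 b; first exact: wlg.
  apply: lonely_or_barelyC34; apply: lonely_or_barelyN2; rewrite -mulrN.
  have {1}-> : v = v + 3 * b + 3 * (- b) by ring.
  have := wlg (- b) (v + 3 * b).
  rewrite oppr_eq0 dvdz_opp coprimezN (_ : v + 3 * b + 3 * - b = v); last by ring.
  by apply=> //; move: b_le0 b0 v3; clear; lia.
move=> v3 v0 w0.
have [b5|b_lt5] := leP 5 b; first by left; apply: lonely4_sum_odd.
have [b3|b_neq3] := eqVneq b 3.
  rewrite b3 in ab *; left; apply: lonely4_sum_nine => //.
  apply/negP => a3; have : (3 %| gcdz a 3)%Z by rewrite dvdz_gcd a3.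
  by rewrite (eqP ab).
have b1 : b = 1 by move: b2 b_gt0 b_lt5 b_neq3; clear; lia.
rewrite {}b1 in w0 *; rewrite mulr1 in w0 *.
have [k aE] := dvdzP a4; rewrite mulrC in aE.
have k0 : k != 0 by apply: contraNneq a0 => k0; rewrite aE k0 mulr0.
have [v_exc|] := boolP ((v == - 1) || (v == - 2)).
  right; exists `|k|%N; first by rewrite absz_gt0.
  have -> : `|(3 * a)%R|%N = (12 * `|k|)%N by rewrite aE; clear; lia.
  have -> : `|(3 : int)|%N = 3%N by [].
  have [[-> ->]|[-> ->]] : (`|v|%N = 1%N /\ `|(v + 3)%R|%N = 2%N) \/
      (`|v|%N = 2%N /\ `|(v + 3)%R|%N = 1%N) by move: v_exc; clear; lia.
    by apply/permP => x /=; clear; lia.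
  by apply/permP => x /=; clear; lia.
rewrite negb_or => /andP[v_1 v_2]; left; rewrite aE.
have [k_gt0|k_le0] := ltP 0 k; first exact: lonely4_tight_pair3.
apply: lonely4N1; rewrite (_ : - (3 * (4 * k)) = 3 * (4 * - k)); last by ring.
by apply: lonely4_tight_pair3 => //; move: k0 k_le0; clear; lia.
Qed.

Lemma quotient_three (R : realType) (a b v m : int) : a != 0 -> b != 0 ->
  coprimez a b -> ~~ (3 %| v)%Z -> v != 0 -> v + 3 * m != 0 ->
  lonely_or_barely R (3 * a) (3 * b) v (v + 3 * m).
Proof.
move=> a0 b0 ab v3 v0 w0.
have [a2|a2] := boolP (2 %| a)%Z; have [b2|b2] := boolP (2 %| b)%Z.
- have : (2 %| gcdz a b)%Z by rewrite dvdz_gcd a2.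
  by rewrite (eqP ab).
- exact: quotient_three_even.
- by apply: lonely_or_barelyC12; apply: quotient_three_even; rewrite // coprimez_sym.
left; have [m2|m2] := boolP (2 %| m)%Z.
  have := dist_int_half_odd R a2; have := dist_int_half_odd R b2.
  by have := dist_int_half_even R m2 => *; apply: (@lonely4_third_gap _ _ _ _ _ (1 / 2)) => //; lra.
by apply: lonely4_twelfths => //; move: a2 b2 v3 m2; clear; lia.
Qed.

Lemma common_factor_three (R : realType) (v1 v2 v3 v4 : int) :
  (3 %| v1)%Z -> (3 %| v2)%Z -> v1 != 0 -> v2 != 0 -> v3 != 0 -> v4 != 0 ->
  (forall q, 1 < q -> ~~ [&& (q %| v1)%Z, (q %| v2)%Z, (q %| v3)%Z & (q %| v4)%Z]) ->
  lonely_or_barely R v1 v2 v3 v4.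
Proof.
move=> d1 d2 v1_0 v2_0 v3_0 v4_0 nodiv.
have [|[a [b [v1E v2E ab v3g v4g]]]] := pair_normal_form R v1_0 v2_0 v3_0 v4_0 nodiv.
  by left.
have g1 : (gcdz v1 v2 %| v1)%Z by exact: dvdz_gcdl.
have g2 : (gcdz v1 v2 %| v2)%Z by exact: dvdz_gcdr.
have gG : (3 %| gcdz v1 v2)%Z by rewrite dvdz_gcd d1.
have G0 : 0 < gcdz v1 v2 by rewrite lt_neqAle eq_sym gcdz_eq0 (negPf v1_0).
move: (gcdz v1 v2) v1E v2E v3g v4g gG G0 g1 g2 => G v1E v2E v3g v4g gG G0 g1 g2.
have [G4|G3] := ltP 3 G; first by left; exact: lonely4_large_factor g1 g2 _ _ _ _ nodiv.
have {gG G0 G3} GE : G = 3 by move: gG G0 G3; clear; lia.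
rewrite {G g1 g2}GE in v1E v2E v3g v4g *.
have ndvd (x : int) : coprimez x 3 -> ~~ (3 %| x)%Z.
  move=> /eqP xg; apply/negP => x3; have : (3 %| gcdz x 3)%Z by rewrite dvdz_gcd x3.
  by rewrite xg.
have v33 := ndvd _ v3g; have v43 := ndvd _ v4g.
have a0 : a != 0 by apply: contraNneq v1_0 => a0; rewrite v1E a0 mulr0.
have b0 : b != 0 by apply: contraNneq v2_0 => b0; rewrite v2E b0 mulr0.
rewrite v1E v2E.
have [/dvdzP[m mE]|/dvdzP[m mE]] : (3 %| v4 - v3)%Z \/ (3 %| - v4 - v3)%Z.
    by move: v33 v43; clear; lia.
  have v4E : v4 = v3 + 3 * m by move: mE; clear; lia.
  by rewrite v4E in v4_0 *; apply: quotient_three.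
have v4E : - v4 = v3 + 3 * m by move: mE; clear; lia.
apply: lonely_or_barelyN; rewrite -oppr_eq0 v4E in v4_0 *.
exact: quotient_three.
Qed.

(** * Maximum loneliness *)

(** Reduces statements on two entries of a tuple to the case of the first two. *)
Lemma tuple_pair_perm (T : eqType) (n : nat) (v : n.+2.-tuple T) (i j : 'I_n.+2) : i != j ->
  exists2 s : seq T, perm_eq (tnth v i :: tnth v j :: s) v & size s = n.
Proof.
move=> ij; set r := [seq k <- enum 'I_n.+2 | (k != i) && (k != j)].
have p : perm_eq (i :: j :: r) (enum 'I_n.+2).
  apply: uniq_perm; rewrite ?enum_uniq //=.
    by rewrite !inE negb_or ij !mem_filter !eqxx /= andbF filter_uniq ?enum_uniq.
  by move=> k; rewrite !inE mem_filter mem_enum andbT; do 2!case: eqP.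
exists (map (tnth v) r).
  by rewrite -[X in perm_eq _ X](map_tnth_enum v); apply: (perm_map (tnth v) p).
by have := perm_size p; rewrite size_enum_ord size_map /= => -[].
Qed.

Lemma loneliness_geP (R : realType) (n : nat) (v : n.+1.-tuple nat) (t c : R) :
  reflect (forall x, x \in v -> c <= dist_int (t * x%:R)) (c <= loneliness v t).
Proof.
apply: (iffP idP) => [ct x /tnthP[i ->]|far].
  by apply: le_trans ct _; exact: (bigmin_inf i).
by apply: le_bigmin => [|i _]; apply: far; exact: mem_tnth.
Qed.

Lemma lonely4_ML (R : realType) (v : 4.-tuple nat) (a b c d : nat) :
  perm_eq [:: a; b; c; d] v -> lonely4 R a b c d -> 1 / 4 <= ML R v.
Proof.
move=> p [t [ta tb tc td]]; apply: le_trans (proj2 (ML_attained R v) t).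
apply/loneliness_geP => x; rewrite -(perm_mem p) !inE.
by case/or4P => /eqP ->.
Qed.

(** The interval (q, (1 - q)/3) obtained from the speeds 1, 2, 3 requires q >= 1/5 to
    exclude the times above 1/3. *)
Lemma ML_tight_family (R : realType) (k : nat) : (0 < k)%N ->
  ML R [tuple 1; 2; 3; 12 * k]%N = (3 * k)%:R / (4 * (3 * k) + 1)%:R.
Proof.
move=> k0; have kR : 1 <= k%:R :> R by rewrite ler1n.
set q : R := _ / _.
have qE : 12 * (q * k%:R) + q = 3 * k%:R.
  have : q * (4 * (3 * k) + 1)%:R = (3 * k)%:R by rewrite divfK // pnatr_eq0 addn1.
  by rewrite natrD !natrM; lra.
have q0 : 0 < q by rewrite divr_gt0 // ltr0n ?muln_gt0 // addn1.
have q5 : 1 / 5 <= q.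
  rewrite leNgt; apply/negP => q5.
  have : 0 <= (1 / 5 - q) * k%:R by rewrite mulr_ge0; lra.
  lra.
have q4 : q <= 1 / 4.
  rewrite leNgt; apply/negP => q4.
  have : 0 <= (q - 1 / 4) * k%:R by rewrite mulr_ge0; lra.
  lra.
move: q qE q0 q5 q4 => q qE q0 q5 q4.
have [[t tE] ub] := ML_attained R [tuple 1; 2; 3; 12 * k]%N.
apply/eqP; rewrite eq_le; apply/andP; split; last first.
  apply: le_trans (ub q); apply/loneliness_geP => x.
  rewrite !inE => /or4P[] /eqP ->.
  - by apply: (@dist_int_ge _ _ _ 0); lra.
  - by apply: (@dist_int_ge _ _ _ 0); lra.
  - by apply: (@dist_int_ge _ _ _ 0); lra.
  rewrite natrM; apply: (@dist_int_ge _ _ _ (3 * k%:Z - 1));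
    by rewrite intrB intrM -[k%:Z%:~R]/(k%:R); lra.
rewrite -tE leNgt; apply/negP => q_lt.
have far c : c \in [:: 1; 2; 3; 12 * k]%N -> q < dist_int (t * c%:R).
  by move=> cv; apply: lt_le_trans q_lt _; apply/loneliness_geP: c cv.
(* Reduction of t modulo 1 and up to sign. *)
have [x [x_gt x_le x_far]] : exists x : R, [/\ q < x, x <= 1 / 2 &
    forall c, c \in [:: 1; 2; 3; 12 * k]%N -> q < dist_int (x * c%:R)].
  have := far 1%N (mem_head _ _); rewrite mulr1 => t_far.
  have [n tn] := dist_int_gap (lexx (dist_int t)).
  have [t_le|t_gt] := leP (t - n%:~R) (1 / 2).
    exists (t - n%:~R); split; [lra|lra|move=> c cv].
    rewrite (@dist_int_periodic _ _ (t * c%:R) (- (n * c%:Z))) ?far //.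
    by rewrite intrN intrM -[c%:Z%:~R]/(c%:R); ring.
  exists (n%:~R + 1 - t); split; [lra|lra|move=> c cv].
  rewrite -dist_intN (@dist_int_periodic _ _ (t * c%:R) (- ((n + 1) * c%:Z))) ?far //.
  by rewrite intrN intrM intrD -[c%:Z%:~R]/(c%:R); ring.
have far_from c (m : int) : c \in [:: 1; 2; 3; 12 * k]%N -> q < `|x * c%:R - m%:~R|.
  by move=> cv; apply: lt_le_trans (x_far c cv) (dist_int_le _ _).
have far2 := far_from 2%N 1 isT; have far3 := far_from 3%N 1 isT.
have {x_far} far12 : q < `|x * (12 * k)%:R - (3 * k%:Z)%:~R|.
  by apply: far_from; rewrite !inE eqxx !orbT.
rewrite ler0_norm in far2; last by lra.
have x3 : 3 * x < 1 - q.
  by have [x3|x3] := leP (x * 3%:R - 1%:~R) 0;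
    [rewrite ler0_norm // in far3|rewrite gtr0_norm // in far3]; lra.
have xk_gt : 0 < (x - q) * k%:R by rewrite mulr_gt0; lra.
have xk_lt : 0 < (1 - q - 3 * x) * k%:R by rewrite mulr_gt0; lra.
move: far12; rewrite natrM intrM -[k%:Z%:~R]/(k%:R) => far12.
have [h|h] := leP (x * (12%:R * k%:R) - 3%:~R * k%:R) 0;
  [rewrite ler0_norm // in far12|rewrite gtr0_norm // in far12]; lra.
Qed.

Theorem theorem2p3 (R : realType) (v : 4.-tuple nat)
    (v_gt0 : forall i : 'I_4, (0 < tnth v i)%N)
    (v_gcd : (\big[gcdn/0]_(i < 4) tnth v i)%N = 1%N) :
  [/\ (exists (i j : 'I_4) (g : nat),
         [/\ i != j, (3 < g)%N, (g %| tnth v i)%N & (g %| tnth v j)%N]) ->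
      1 / 4 <= ML R v,
      (exists i j : 'I_4,
         [/\ i != j, (3 %| tnth v i)%N & (3 %| tnth v j)%N]) ->
      ~ (exists k : nat,
           (0 < k)%N /\ perm_eq v [:: 1; 2; 3; 12 * k]%N) ->
      1 / 4 <= ML R v
    & forall k : nat, (0 < k)%N -> v = [tuple 1; 2; 3; 12 * k]%N ->
      ML R v = (3 * k)%:R / (4 * (3 * k) + 1)%:R].
Proof.
have nodiv q : (1 < q)%N -> ~~ all (dvdn q) v.
  move=> q1; apply/negP => /allP qv.
  have : (q %| \big[gcdn/0]_(i < 4) tnth v i)%N.
    apply: (big_ind (fun x => (q %| x)%N)) => [||i _]; rewrite ?dvdn0 //.
      by move=> x y; rewrite dvdn_gcd => -> ->.
    exact: qv (mem_tnth _ _).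
  by rewrite v_gcd dvdn1; case: eqP q1 => // ->.
have nz x : x \in v -> x%:Z != 0.
  by move=> /tnthP[i ->]; have := v_gt0 i; case: (tnth v i).
have complete i j : i != j -> exists c d : nat,
    [/\ perm_eq [:: tnth v i; tnth v j; c; d] v, [&& (tnth v i)%:Z != 0,
      (tnth v j)%:Z != 0, c%:Z != 0 & d%:Z != 0] &
      forall q : int, 1 < q -> ~~ [&& (q %| (tnth v i)%:Z)%Z, (q %| (tnth v j)%:Z)%Z,
        (q %| c%:Z)%Z & (q %| d%:Z)%Z]].
  move=> /(tuple_pair_perm v)[[|c [|d [|? ?]]]] // p _; exists c, d; split=> //.
    by rewrite !nz // -(perm_mem p) !inE eqxx ?orbT.
  case=> // q q1; have := nodiv q q1; rewrite -(perm_all _ p) /= andbT.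
  by rewrite !dvdzE.
split=> [[i [j [g [ij g3 gi gj]]]]|[i [j [ij d_i d_j]]] not_barely|k k0 ->].
- have [c [d [p /and4P[i0 j0 c0 d0] nd]]] := complete i j ij.
  by apply: (lonely4_ML p); apply: (@lonely4_large_factor R g).
- have [c [d [p /and4P[i0 j0 c0 d0] nd]]] := complete i j ij.
  have [lon|[k k0 pk]] :=
      @common_factor_three R (tnth v i)%:Z (tnth v j)%:Z c d d_i d_j i0 j0 c0 d0 nd.
    exact: lonely4_ML p lon.
  by case: not_barely; exists k; split=> //; rewrite -(permPl p).
exact: ML_tight_family.
Qed.
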